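(* Let $\mathcal G$ be a connected matrix Lie group with Lie algebra $\mathfrak g$ and a nondegenerate bi-invariant symmetric bilinear form $\langle,\rangle$ on $\mathfrak g$. Let $\mathcal A$ be a connected Lie subgroup of $\mathcal G$ with Lie algebra $\mathfrak a\subset\mathfrak g$ such that $\langle,\rangle$ restricted to $\mathfrak a$ is nondegenerate, let $\mathcal B$ be an invertible intertwining operator on $\mathfrak a$, let $\beta_0\ne0$ be a real number, and write $\vec\beta=(\beta_0,\mathcal B)$. Equip $\mathcal G$ with the left-invariant metric defined by the form on $\mathfrak g$ $$\langle\mathtt X_1,\mathtt X_2\rangle_{\vec\beta}:=\beta_0\langle\mathtt X_1,\mathtt X_2\rangle-\langle(\mathcal B+\beta_0 I_{\mathfrak a})\mathcal P_{\mathfrak a}\mathtt X_1,\mathcal P_{\mathfrak a}\mathtt X_2\rangle .\qquad(\ast)$$ Let $\tilde{\mathcal G}=\mathcal G\times\mathcal A$ and $\tilde{\mathcal H}=\{(H,H)\in\tilde{\mathcal G}: H\in\mathcal A\}$, and identify $\mathcal G$ with $\tilde{\mathcal G}/\tilde{\mathcal H}$ via the isometric action $(X,A).Y=XYA^{-1}$ (with isotropy group $\tilde{\mathcal H}$ at the identity). Then the metric $(\ast)$ is naturally reductive when $\mathcal G$ is identified with $\tilde{\mathcal G}/\tilde{\mathcal H}$. Specifically, let $\tilde{\mathfrak g}=\mathfrak g\times\mathfrak a$ and $\tilde{\mathfrak h}$ be the Lie algebras of $\tilde{\mathcal G}$ and $\tilde{\mathcal H}$, and let $\hat{\mathcal B}:=(\mathcal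 B+\beta_0I_{\mathfrak a})\mathcal B^{-1}$. Then $$\tilde{\mathfrak h}=\{(\mathtt A,\mathtt A)\in\tilde{\mathfrak g}:\mathtt A\in\mathfrak a\},\qquad \tilde{\mathfrak m}:=\{(\mathtt X,\hat{\mathcal B}\mathcal P_{\mathfrak a}\mathtt X):\mathtt X\in\mathfrak g\}$$ are complementary subspaces, $\tilde{\mathfrak g}=\tilde{\mathfrak m}+\tilde{\mathfrak h}$ and $\tilde{\mathfrak m}\cap\tilde{\mathfrak h}=\{0\}$, with the decomposition (first term in $\tilde{\mathfrak m}$, second in $\tilde{\mathfrak h}$) $$(\mathtt X,\mathtt A)=\Big(\mathtt X-(I_{\mathfrak a}+\beta_0^{-1}\mathcal B)\mathcal P_{\mathfrak a}\mathtt X+\beta_0^{-1}\mathcal B\mathtt A,\;-(I_{\mathfrak a}+\beta_0^{-1}\mathcal B)\mathcal P_{\mathfrak a}(\mathtt X-\mathtt A)\Big)$$ $$+\Big(\mathtt A+(I_{\mathfrak a}+\beta_0^{-1}\mathcal B)\mathcal P_{\mathfrak a}(\mathtt X-\mathtt A),\;\mathtt A+(I_{\mathfrak a}+\beta_0^{-1}\mathcal B)\mathcal P_{\mathfrak a}(\mathtt X-\mathtt A)\Big).$$ The space $\tilde{\mathfrak m}$ is $\operatorname{Ad}_{\tilde{\mathcal H}}$-invariant. The following bilinear form on $\tilde{\mathfrak m}$ $$\langle(\mathtt X_1,\hat{\mathcal B}\mathcal P_{\mathfrak a}\mathtt X_1),(\mathtt X_2,\hat{\mathcal B}\mathcal P_{\mathfrak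 a}\mathtt X_2)\rangle_{\tilde{\mathfrak m}}:=\beta_0\langle\mathtt X_1,\mathtt X_2\rangle-\langle\beta_0^2\mathcal B^{-1}(I_{\mathfrak a}+\beta_0^{-1}\mathcal B)\mathcal P_{\mathfrak a}\mathtt X_1,\mathcal P_{\mathfrak a}\mathtt X_2\rangle\qquad(\ast\ast)$$ satisfies the naturally reductive condition and induces the metric $(\ast)$ on $\mathcal G$. If $I_{\mathfrak a}+\beta_0^{-1}\mathcal B$ is invertible, then for $(\mathtt X_1,\mathtt A_1),(\mathtt X_2,\mathtt A_2)\in\mathfrak g\times\mathfrak a$ define $$\langle(\mathtt X_1,\mathtt A_1),(\mathtt X_2,\mathtt A_2)\rangle_{\tilde{\mathcal G},\vec\beta}:=\beta_0\langle\mathtt X_1,\mathtt X_2\rangle-\langle\beta_0\mathcal B(\mathcal B+\beta_0I_{\mathfrak a})^{-1}\mathtt A_1,\mathtt A_2\rangle .$$ This metric is bi-invariant on $\tilde{\mathcal G}$ and restricts to $(\ast\ast)$ on $\tilde{\mathfrak m}$. The mapping $\mathfrak q:\tilde{\mathcal G}\to\mathcal G$, $\mathfrak q(X,A)=XA^{-1}$, is a pseudo-Riemannian submersion between $\langle,\rangle_{\tilde{\mathcal G},\vec\beta}$ and $\langle,\rangle_{\vec\beta}$.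
   Context: A matrix Lie group is a Lie subgroup of some $\mathrm{GL}(N)$; $\tilde{\mathcal G}=\mathcal G\times\mathcal A$ has componentwise multiplication. A form $\langle,\rangle$ on the Lie algebra of a connected group is bi-invariant if it is $\operatorname{Ad}$-invariant, equivalently $\langle\mathtt A,[\mathtt B,\mathtt C]\rangle=\langle\mathtt B,[\mathtt C,\mathtt A]\rangle=\langle\mathtt C,[\mathtt A,\mathtt B]\rangle$. An intertwining operator on $\mathfrak a$ is a linear operator $\mathcal B:\mathfrak a\to\mathfrak a$, symmetric with respect to $\langle,\rangle$, such that $(\mathtt A_1,\mathtt A_2)\mapsto\langle\mathtt A_1,\mathcal B\mathtt A_2\rangle$ is also bi-invariant on $\mathfrak a$. $I_{\mathfrak a}$ is the identity of $\mathfrak a$ and $\mathcal P_{\mathfrak a}:\mathfrak g\to\mathfrak a$ the $\langle,\rangle$-orthogonal projection. A form on $\mathfrak g$ induces the left-invariant metric $\langle\xi,\eta\rangle_X=\langle X^{-1}\xi,X^{-1}\eta\rangle$ for $\xi,\eta\in T_X\mathcal G$; metrics are pseudo-Riemannian (nondegenerate, possibly indefinite). Naturally reductive: a pseudo-Riemannian homogeneous space $G/K$ with Lie algebras $\mathfrak g,\mathfrak k$ is reductive if there is an $\operatorname{Ad}_K$-invariant complement $\mathfrak m$ of $\mathfrak k$ in $\mathfrak g$; $G$-invariant metrics then correspond to invariant nondegenerate symmetric forms on $\mathfrak m$ (infinitesimally, $\langle[\mathtt K,\mathtt M_1],\mathtt M_2\rangle+\langle\mathtt M_1,[\mathtt K,\mathtt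 M_2]\rangle=0$ for $\mathtt K\in\mathfrak k$, $\mathtt M_1,\mathtt M_2\in\mathfrak m$). It is naturally reductive if moreover $\langle\mathtt M_1,\mathcal P_{\mathfrak m}[\mathtt M_2,\mathtt M_3]\rangle=\langle\mathtt M_2,\mathcal P_{\mathfrak m}[\mathtt M_3,\mathtt M_1]\rangle$ for all $\mathtt M_1,\mathtt M_2,\mathtt M_3\in\mathfrak m$, where $\mathcal P_{\mathfrak m}$ is the projection to $\mathfrak m$ along $\mathfrak k$. Here this is applied with $\tilde{\mathcal G},\tilde{\mathcal H},\tilde{\mathfrak m}$. *)

(* Defs.v *)
From HB Require Import structures.
From mathcomp Require Import all_boot all_order all_algebra.
From mathcomp Require Import all_classical all_reals all_analysis.

Set Implicit Arguments.
Unset Strict Implicit.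
Unset Printing Implicit Defensive.

Import Order.TTheory GRing.Theory Num.Theory.
Import numFieldNormedType.Exports.

Local Open Scope classical_set_scope.
Local Open Scope ring_scope.

(* In finite dimension, a map is C^(k+1) on an open set iff it is differentiable
   there and all its directional derivatives are C^k. *)
Fixpoint Ck (R : realType) (V W : normedModType R) (k : nat)
    (U : set V) (f : V -> W) : Prop :=
  match k with
  | 0 => forall x, U x -> {for x, continuous f}
  | k'.+1 => (forall x, U x -> differentiable f x) /\
             forall v : V, Ck k' U (fun x => 'd f x v)
  end.

Definition smooth_on (R : realType) (V W : normedModType R)
    (U : set V) (f : V -> W) : Prop :=
  forall k, Ck k U f.

(* A subset of E together with an atlas of local parametrisations: a pair (D, p)
   stands for p : D -> E with D an open subset of R^mdim.  The conditions are in
   [immersed]. *)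
Record submfd (R : realType) (E : normedModType R) := Submfd {
  pts : set E;
  mdim : nat;
  charts : set (set 'rV[R]_mdim * ('rV[R]_mdim -> E))
}.
Arguments charts {R E} s _.

(* The set of u where f, read in the charts c and c', is defined. *)
Definition chart_dom (R : realType) (E F : normedModType R) (d e : nat)
    (c : set 'rV[R]_d * ('rV[R]_d -> E)) (c' : set 'rV[R]_e * ('rV[R]_e -> F))
    (f : E -> F) : set 'rV[R]_d :=
  [set u | c.1 u /\ exists2 v, c'.1 v & c'.2 v = f (c.2 u)].

(* Openness of [chart_dom] is continuity for the manifold topologies; t is the
   local expression of f. *)
Definition smooth_map (R : realType) (E F : normedModType R)
    (S : submfd E) (T : submfd F) (f : E -> F) : Prop :=
  set_fun (pts S) (pts T) f /\
  forall c c', charts S c -> charts T c' ->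
    open (chart_dom c c' f) /\
    exists t : 'rV[R]_(mdim S) -> 'rV[R]_(mdim T),
      smooth_on (chart_dom c c' f) t /\
      forall u, chart_dom c c' f u -> c'.1 (t u) /\ c'.2 (t u) = f (c.2 u).

(* The last condition says that the changes of charts are smooth with open
   domains.  The manifold topology is Hausdorff because it refines the topology
   of E; second countability is not imposed, but it is automatic for connected
   Lie groups. *)
Definition immersed (R : realType) (E : normedModType R) (S : submfd E) : Prop :=
  [/\ forall c, charts S c ->
        [/\ open c.1, smooth_on c.1 c.2, set_inj c.1 c.2, set_fun c.1 (pts S) c.2 &
            forall u, c.1 u -> injective ('d (c.2) u)],
      forall x, pts S x -> exists c u, [/\ charts S c, c.1 u & c.2 u = x] &
      smooth_map S S id].

Definition mfd_open (R : realType) (E : normedModType R) (S : submfd E)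
    (O : set E) : Prop :=
  forall c, charts S c -> open (c.1 `&` c.2 @^-1` O).

Definition mfd_connected (R : realType) (E : normedModType R)
    (S : submfd E) : Prop :=
  forall O, O `<=` pts S -> mfd_open S O -> mfd_open S (pts S `\` O) ->
    O = set0 \/ O = pts S.

Definition tangent (R : realType) (E : normedModType R) (S : submfd E) (x : E) :
    set E :=
  [set v | exists c u w, [/\ charts S c, c.1 u, c.2 u = x & v = 'd (c.2) u w]].

Definition prod_submfd (R : realType) (E F : normedModType R)
    (S : submfd E) (T : submfd F) : submfd (E * F)%type :=
  @Submfd R (E * F)%type (pts S `*` pts T) (mdim S + mdim T)
    [set c | exists c1 c2, [/\ charts S c1, charts T c2 &
       c = ([set w | c1.1 (lsubmx w) /\ c2.1 (rsubmx w)],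
            fun w => (c1.2 (lsubmx w), c2.2 (rsubmx w)))]].

Definition diag_submfd (R : realType) (E : normedModType R) (S : submfd E) :
    submfd (E * E)%type :=
  @Submfd R (E * E)%type [set z | pts S z.1 /\ z.2 = z.1] (mdim S)
    [set c | exists2 c1, charts S c1 & c = (c1.1, fun u => (c1.2 u, c1.2 u))].

(* Total operations on E; they satisfy the group laws only on a subset.  The
   multiplications used are bilinear on E, which makes [Ad] the adjoint action and
   [brk] the Lie bracket of the tangent space at the unit. *)
Record gops (E : Type) := Gops {
  gmul : E -> E -> E;
  gone : E;
  ginv : E -> E
}.

Definition GL_ops (R : realType) (N : nat) : gops 'M[R]_N :=
  Gops mulmx 1%:M invmx.

Definition prod_ops (E F : Type) (o : gops E) (o' : gops F) : gops (E * F) :=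
  Gops (fun x y => (gmul o x.1 y.1, gmul o' x.2 y.2))
       (gone o, gone o')
       (fun x => (ginv o x.1, ginv o' x.2)).

Definition Ad (E : Type) (o : gops E) (x y : E) : E :=
  gmul o (gmul o x y) (ginv o x).

Definition brk (E : zmodType) (o : gops E) (x y : E) : E :=
  gmul o x y - gmul o y x.

Definition lie_group (R : realType) (E : normedModType R) (o : gops E)
    (G : submfd E) : Prop :=
  [/\ immersed G,
      pts G (gone o),
      [/\ forall x y z, pts G x -> pts G y -> pts G z ->
            gmul o x (gmul o y z) = gmul o (gmul o x y) z,
          forall x, pts G x -> gmul o (gone o) x = x &
          forall x, pts G x -> gmul o (ginv o x) x = gone o],
      smooth_map (prod_submfd G G) G (fun z => gmul o z.1 z.2) &
      smooth_map G G (ginv o)].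

(* The inclusion H -> G is an immersion since H -> E is one. *)
Definition lie_subgroup (R : realType) (E : normedModType R) (o : gops E)
    (H G : submfd E) : Prop :=
  [/\ lie_group o H, pts H `<=` pts G & smooth_map H G id].

Definition matrix_lie_group (R : realType) (N : nat)
    (G : submfd 'M[R]_N) : Prop :=
  lie_group (GL_ops R N) G /\ pts G `<=` [set X | X \in unitmx].

Definition lie_algebra (R : realType) (E : normedModType R) (o : gops E)
    (G : submfd E) : set E :=
  tangent G (gone o).

Definition sym_form (R : realType) (E : lmodType R) (V : set E)
    (b : E -> E -> R) : Prop :=
  (forall x y, V x -> V y -> b x y = b y x) /\
  (forall (k : R) x y z, V x -> V y -> V z ->
     b (k *: x + y) z = k * b x z + b y z).

Definition nondegenerate_on (R : realType) (E : lmodType R) (V : set E)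
    (b : E -> E -> R) : Prop :=
  forall x, V x -> (forall y, V y -> b x y = 0) -> x = 0.

Definition bi_invariant (R : realType) (E : normedModType R) (o : gops E)
    (G : submfd E) (b : E -> E -> R) : Prop :=
  forall x y z, pts G x -> lie_algebra o G y -> lie_algebra o G z ->
    b (Ad o x y) (Ad o x z) = b y z.

Definition intertwining (R : realType) (E : normedModType R) (o : gops E)
    (G : submfd E) (b : E -> E -> R) (B : E -> E) : Prop :=
  let a := lie_algebra o G in
  [/\ set_fun a a B,
      forall (k : R) x y, a x -> a y -> B (k *: x + y) = k *: B x + B y,
      forall x y, a x -> a y -> b (B x) y = b x (B y) &
      bi_invariant o G (fun x y => b x (B y))].

(* Inverse of an operator f of V, meaningful when f is a bijection of V. *)
Definition inv_on (R : realType) (E : lmodType R) (V : set E) (f : E -> E) :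
    E -> E :=
  'pinv_(fun=> 0) V f.

Definition orth_proj (R : realType) (E : normedModType R) (b : E -> E -> R)
    (V : set E) (x : E) : E :=
  xget 0 [set y | V y /\ forall z, V z -> b (x - y) z = 0].

Definition proj_along (R : realType) (E : normedModType R) (m h : set E)
    (x : E) : E :=
  xget 0 [set y | m y /\ h (x - y)].

(* The left-invariant metric of a form b on the Lie algebra. *)
Definition left_metric (R : realType) (E : normedModType R) (o : gops E)
    (b : E -> E -> R) (x xi eta : E) : R :=
  b (gmul o (ginv o x) xi) (gmul o (ginv o x) eta).

(* Maps between submanifolds are given by ambient maps, differentiable at the
   points considered; the tangent map is the restriction of their differential. *)
Definition isometric (R : realType) (F : normedModType R) (M : submfd F)
    (met : F -> F -> F -> R) (f : F -> F) : Prop :=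
  forall x, pts M x -> differentiable f x /\
    forall xi eta, tangent M x xi -> tangent M x eta ->
      met (f x) ('d f x xi) ('d f x eta) = met x xi eta.

Definition pr_submersion (R : realType) (E F : normedModType R)
    (S : submfd E) (metS : E -> E -> E -> R)
    (T : submfd F) (metT : F -> F -> F -> R) (f : E -> F) : Prop :=
  [/\ smooth_map S T f,
      set_surj (pts S) (pts T) f &
      forall p, pts S p ->
        let vert := [set xi | tangent S p xi /\ 'd f p xi = 0] in
        let horiz := [set xi | tangent S p xi /\
                               forall nu, vert nu -> metS p xi nu = 0] in
        [/\ differentiable f p,
            set_surj (tangent S p) (tangent T (f p)) ('d f p),
            nondegenerate_on vert (metS p) &
            forall xi eta, horiz xi -> horiz eta ->
              metT (f p) ('d f p xi) ('d f p eta) = metS p xi eta]].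

(* M is identified with G/K by the orbit map of the point pt. *)
Definition homogeneous (R : realType) (E F : normedModType R) (o : gops E)
    (G K : submfd E) (M : submfd F) (act : E -> F -> F) (pt : F) : Prop :=
  [/\ lie_group o G /\ lie_subgroup o K G,
      smooth_map (prod_submfd G M) M (fun z => act z.1 z.2),
      (forall y, pts M y -> act (gone o) y = y) /\
      (forall p q y, pts G p -> pts G q -> pts M y ->
         act (gmul o p q) y = act p (act q y)),
      pts M pt /\ (forall y, pts M y -> exists2 p, pts G p & act p pt = y) &
      [set p | pts G p /\ act p pt = pt] = pts K].

Definition complementary (R : realType) (E : lmodType R) (g m h : set E) : Prop :=
  [/\ m 0 /\ (forall (k : R) x y, m x -> m y -> m (k *: x + y)),
      h 0 /\ (forall (k : R) x y, h x -> h y -> h (k *: x + y)),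
      g = [set z | exists x y, [/\ m x, h y & z = x + y]] &
      m `&` h = [set 0]].

Definition Ad_invariant (R : realType) (E : normedModType R) (o : gops E)
    (K : submfd E) (m : set E) : Prop :=
  forall k x, pts K k -> m x -> m (Ad o k x).

Definition invariant_form (R : realType) (E : normedModType R) (o : gops E)
    (K : submfd E) (m : set E) (b : E -> E -> R) : Prop :=
  [/\ sym_form m b, nondegenerate_on m b &
      forall k x y, pts K k -> m x -> m y -> b (Ad o k x) (Ad o k y) = b x y].

Definition nr_condition (R : realType) (E : normedModType R) (o : gops E)
    (K : submfd E) (m : set E) (b : E -> E -> R) : Prop :=
  let Pm := proj_along m (lie_algebra o K) in
  forall x y z, m x -> m y -> m z ->
    b x (Pm (brk o y z)) = b y (Pm (brk o z x)).

(* The G-invariant metric of M = G/K which corresponds to the form b on m, m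
   being identified with the tangent space at pt. *)
Definition induces (R : realType) (E F : normedModType R) (o : gops E)
    (G : submfd E) (M : submfd F) (act : E -> F -> F) (pt : F)
    (m : set E) (b : E -> E -> R) (met : F -> F -> F -> R) : Prop :=
  let orb := fun p => act p pt in
  forall p, pts G p ->
    [/\ differentiable orb p,
        [set 'd orb p (gmul o p x) | x in m] = tangent M (orb p) &
        forall x y, m x -> m y ->
          met (orb p) ('d orb p (gmul o p x)) ('d orb p (gmul o p y)) = b x y].

Definition naturally_reductive (R : realType) (E F : normedModType R)
    (o : gops E) (G K : submfd E) (M : submfd F) (act : E -> F -> F) (pt : F)
    (met : F -> F -> F -> R) : Prop :=
  [/\ homogeneous o G K M act pt,
      (forall p, pts G p -> isometric M met (act p)) &
      exists m b,
        [/\ complementary (lie_algebra o G) m (lie_algebra o K),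
            Ad_invariant o K m,
            invariant_form o K m b,
            nr_condition o K m b &
            induces o G M act pt m b met]].

Section Metrics.
Context (R : realType) (N : nat).
Variables (A : submfd 'M[R]_N) (form : 'M[R]_N -> 'M[R]_N -> R).
Variables (beta0 : R) (B : 'M[R]_N -> 'M[R]_N).

Definition proj_a : 'M[R]_N -> 'M[R]_N :=
  orth_proj form (lie_algebra (GL_ops R N) A).

Definition Binv : 'M[R]_N -> 'M[R]_N :=
  inv_on (lie_algebra (GL_ops R N) A) B.

Definition Bplus (X : 'M[R]_N) : 'M[R]_N := B X + beta0 *: X.

Definition IB (X : 'M[R]_N) : 'M[R]_N := X + beta0^-1 *: B X.

Definition Bhat (X : 'M[R]_N) : 'M[R]_N := Bplus (Binv X).

Definition form_beta (X Y : 'M[R]_N) : R :=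
  beta0 * form X Y - form (Bplus (proj_a X)) (proj_a Y).

Definition mtilde (g : set 'M[R]_N) : set ('M[R]_N * 'M[R]_N) :=
  [set z | g z.1 /\ z.2 = Bhat (proj_a z.1)].

(* An element of mtilde is determined by its first component. *)
Definition form_m (z w : 'M[R]_N * 'M[R]_N) : R :=
  beta0 * form z.1 w.1
  - form (beta0 ^+ 2 *: Binv (IB (proj_a z.1))) (proj_a w.1).

Definition form_Gt (z w : 'M[R]_N * 'M[R]_N) : R :=
  beta0 * form z.1 w.1
  - form (beta0 *: B (inv_on (lie_algebra (GL_ops R N) A) Bplus z.2)) w.2.

End Metrics.

Definition two_sided (R : realType) (N : nat) (p : 'M[R]_N * 'M[R]_N)
    (Y : 'M[R]_N) : 'M[R]_N :=
  p.1 *m Y *m invmx p.2.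

Definition qmap (R : realType) (N : nat) (p : 'M[R]_N * 'M[R]_N) : 'M[R]_N :=
  p.1 *m invmx p.2.

(* Main.v *)
Require Import Defs.
From HB Require Import structures.
From mathcomp Require Import all_boot all_order all_algebra.
From mathcomp Require Import all_classical all_reals all_analysis.
From mathcomp Require Import ring.
Import Order.TTheory GRing.Theory Num.Theory.
Import numFieldNormedType.Exports.
Local Open Scope classical_set_scope.
Local Open Scope ring_scope.

Set Implicit Arguments.
Unset Strict Implicit.
Unset Printing Implicit Defensive.

(** The statement mixes differential geometry with linear algebra; left
    translation reduces the former to the latter.

    The orbit map (X, A) |-> X A^-1 has differential
    p.(X, Y) |-> p1 (X - Y) p2^-1 at p = (p1, p2) (lemma [is_diff_orb]), and the
    left translate of that vector to the unit of G is Ad_{p2} (X - Y).  The form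
    beta0 <X, Y> - <(B + beta0) P X, P Y> is invariant under Ad_A, because the
    orthogonal projection P on the subalgebra a and the operator B commute with
    Ad_A.  So the two-sided action is isometric, and the form on the complement
    m that induces the metric is this form, pulled back along the map
    (X, Y) |-> X - Y.  On m, whose elements are the pairs (X, Bhat P X), that map
    is X |-> X - Bhat P X, a bijection onto g ([sub_hatB_surj],
    [hatB_fixed_eq0]); it kills the diagonal, so m and the diagonal are
    complementary, and the pulled-back form is the stated one ([m_formE]).

    Natural reductivity rests on one computation, [m_form_bracket]: the pairing
    of Z with the m-part of the bracket of X and Y is
    beta0 (<Z, [X, Y]> - <P Z, [Bhat P X, Bhat P Y]>).  The first term is
    invariant under cyclic permutations since the form is bi-invariant, the
    second one since Bhat is moreover self-adjoint and commutes with the adjoint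
    action of a ([cubic_cyclic]).

    When I + beta0^-1 B is invertible, the form on g x a makes m the orthogonal
    of the diagonal ([horizontal_in_m]) and agrees with the form on m.  The
    vertical space of (X, A) |-> X A^-1 at p is the translate of the diagonal by
    p, the horizontal space is the translate of m, and the map is a
    pseudo-Riemannian submersion.

    Three ingredients are needed to make this precise.  Maps between charted
    subsets are smooth when their chart expressions are; these maps are closed
    under composition, pairing and projections, by a chain rule for C^k maps
    ([Ck_comp]).  The infinitesimal form of Ad-invariance, [bracket_invariant],
    comes from differentiating <Ad_x y, z> = <y, Ad_{x^-1} z> at the unit.
    Finally the form and the operators are constrained on g or a only;
    [metric_data_exists] replaces them by global objects which agree with them
    there, so that the algebra can be done without domain conditions. *)

(** * Calculus of C^k maps and of matrix-valued maps *)

(** Being differentiable is a local property, so differentials of chart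
    expressions that coincide on an open set only can be compared. *)
Lemma near_eq_diff (R : realType) (V W : normedModType R) (f g : V -> W) (x : V) :
  (\forall y \near x, f y = g y) -> differentiable f x ->
  differentiable g x /\ 'd g x = 'd f x :> (V -> W).
Proof.
move=> fg df.
have fgx : f x = g x by exact: nbhs_singleton fg.
have H : g \o shift x = cst (g x) + 'd f x +o_ 0 id.
  apply/eqaddoP => e e0; have /diff_locally/eqaddoP/(_ e e0) := df.
  have : \forall y \near 0, f (y + x) = g (y + x).
    by move: fg; rewrite (near_shift 0) subr0.
  move=> fg0; apply: filter_app; near=> y => /=.
  have : f (y + x) = g (y + x) by near: y.
  by rewrite /= !fctE /= => <-; rewrite -fgx.
have dg : 'd g x = 'd f x :> (V -> W).
  by apply: diff_unique => //; exact: diff_continuous.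
split=> //; apply/diff_locallyP; rewrite dg; split=> //; exact: diff_continuous.
Unshelve. all: by end_near. Qed.

(** The chain rule for a composition given as a lambda-term; [f] and [g] are
    explicit because higher-order unification would guess them wrongly. *)
Lemma diff_compE (R : realType) (U V W : normedModType R) (f : U -> V)
    (g : V -> W) x v : differentiable f x -> differentiable g (f x) ->
  'd (fun y => g (f y)) x v = 'd g (f x) ('d f x v).
Proof.
move=> df dg; rewrite -[RHS]/(('d g (f x) \o 'd f x) v) -diff_comp//.
Qed.

Arguments diff_compE {R U V W} f g x v.

Lemma diff_linE (R : realType) (V W : normedModType R) (L : {linear V -> W}) x v :
  continuous L -> 'd L x v = L v.
Proof. by move=> cL; rewrite diff_lin. Qed.

Lemma mx_differentiable (R : realType) (V : normedModType R) m n
    (f : V -> 'M[R]_(m, n)) (x : V) :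
  (forall i j, differentiable (fun y => f y i j : R) x) -> differentiable f x.
Proof.
move=> df.
have -> : f = \sum_(i < m) \sum_(j < n) (fun y => f y i j *: delta_mx i j).
  apply/funext => y; rewrite fct_sumE [LHS]matrix_sum_delta.
  by apply: eq_bigr => i _; rewrite fct_sumE.
apply: differentiable_sum => i; apply: differentiable_sum => j.
exact: differentiableZl.
Qed.

(** Expansion in the elementary matrices: the domain is finite-dimensional. *)
Lemma linear_mx_continuous (R : realType) (W : normedModType R) m n
    (f : {linear 'M[R]_(m, n) -> W}) : continuous f.
Proof.
move=> x; apply: differentiable_continuous.
have -> : (f : _ -> _) =
    \sum_(i < m) \sum_(j < n) (fun y : 'M[R]_(m, n) => y i j *: f (delta_mx i j)).
  apply/funext => y; rewrite fct_sumE [in LHS](matrix_sum_delta y) linear_sum.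
  apply: eq_bigr => i _; rewrite fct_sumE linear_sum.
  by apply: eq_bigr => j _; rewrite linearZ.
apply: differentiable_sum => i; apply: differentiable_sum => j.
by apply: differentiableZl; exact: differentiable_coord.
Qed.

Section Ck.
Variable R : realType.
Implicit Types (V W : normedModType R).

(** Openness matters: the differentials in the definition of C^k depend on a
    neighbourhood of the point. *)
Lemma Ck_eq V W k (U : set V) (f g : V -> W) :
  open U -> (forall x, U x -> f x = g x) -> Ck k U f -> Ck k U g.
Proof.
move=> oU; elim: k f g => [|k IH] f g fg /=.
  move=> cf x Ux; have := cf x Ux; rewrite /prop_for /continuous_at -fg//.
  apply: cvg_trans; apply: near_eq_cvg.
  by near=> y; rewrite fg//; near: y; exact: open_nbhs_nbhs.
move=> [df Cf].
have fgx x : U x -> \forall y \near x, f y = g y.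
  by move=> Ux; near=> y; apply: fg; near: y; exact: open_nbhs_nbhs.
split=> [x Ux|v]; first by have [] := near_eq_diff (fgx x Ux) (df x Ux).
apply: IH (Cf v) => x Ux.
by have [_ ->] := near_eq_diff (fgx x Ux) (df x Ux).
Unshelve. all: by end_near. Qed.

Lemma Ck_sub V W k (U U' : set V) (f : V -> W) :
  U' `<=` U -> Ck k U f -> Ck k U' f.
Proof.
move=> UU; elim: k f => [|k IH] f /=; first by move=> cf x /UU/cf.
by move=> [df Cf]; split=> [x /UU/df//|v]; exact: IH.
Qed.

(** A differentiable map is continuous; the induction carries this up. *)
Lemma CkW V W k (U : set V) (f : V -> W) : Ck k.+1 U f -> Ck k U f.
Proof.
elim: k f => [|k IH] f [df Cf].
  by move=> x Ux; apply: differentiable_continuous; exact: df.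
by split=> // v; apply: IH; exact: Cf.
Qed.

Lemma Ck_local V W k (U : set V) (f : V -> W) :
  (forall x, U x -> exists2 Q, open Q /\ Q x & Ck k Q f) -> Ck k U f.
Proof.
elim: k f => [|k IH] f H /=; first by move=> x /H[Q [_ Qx]] cf; exact: cf.
split=> [x /H[Q [_ Qx] [df _]]|v]; first exact: df.
by apply: IH => x /H[Q Qx [_ Cf]]; exists Q => //; exact: Cf.
Qed.

Lemma smooth_local V W (U : set V) (f : V -> W) :
  (forall x, U x -> exists Q g, [/\ open Q, Q x, smooth_on Q g &
     forall y, Q y -> g y = f y]) -> smooth_on U f.
Proof.
move=> H k; apply: Ck_local => x /H[Q [g [oQ Qx sg gf]]].
by exists Q => //; exact: Ck_eq gf (sg k).
Qed.

Lemma Ck_cst V W k (U : set V) (a : W) : Ck k U (cst a).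
Proof.
elim: k a => [|k IH] a /=; first by move=> x _; exact: cst_continuous.
split=> [x _|v]; first exact: differentiable_cst.
rewrite (_ : (fun x => _) = cst 0); first exact: IH.
by apply/funext => x; rewrite diff_cst.
Qed.

Lemma CkD V W k (U : set V) (f g : V -> W) : open U ->
  Ck k U f -> Ck k U g -> Ck k U (fun x => f x + g x).
Proof.
move=> oU; elim: k f g => [|k IH] f g /=.
  by move=> cf cg x Ux; apply: continuousD; [exact: cf|exact: cg].
move=> [df Cf] [dg Cg]; split=> [x Ux|v].
  by apply: differentiableD; [exact: df|exact: dg].
apply: Ck_eq (IH _ _ (Cf v) (Cg v)) => // x Ux.
by rewrite (_ : (fun x => f x + g x) = f + g)// diffD//; [exact: df|exact: dg].
Qed.

Lemma Ck_sum V W k (U : set V) n (f : 'I_n -> V -> W) : open U ->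
  (forall i, Ck k U (f i)) -> Ck k U (fun x => \sum_(i < n) f i x).
Proof.
move=> oU; elim: n f => [|n IH] f H.
  by under eq_fun do rewrite big_ord0; exact: Ck_cst.
under eq_fun do rewrite big_ord_recr /=.
by apply: CkD => //; exact: IH.
Qed.

(** Leibniz rule: the differential of h f is a sum of products of C^k maps.  The
    induction needs [h] and [f] themselves to be C^k, whence [CkW]. *)
Lemma CkZ V W k (U : set V) (h : V -> R) (f : V -> W) : open U ->
  Ck k U h -> Ck k U f -> Ck k U (fun x => h x *: f x).
Proof.
move=> oU; elim: k h f => [|k IH] h f Ch Cf.
  by move=> x Ux; apply: continuousZ; [exact: Ch|exact: Cf].
have [dh Ch'] := Ch; have [df Cf'] := Cf.
(* Scaling is packed as a bilinear map to apply its differentiation rule. *)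
have key x : U x -> is_diff x (fun x => h x *: f x)
    (fun v => 'd h x v *: f x + h x *: 'd f x v).
  move=> Ux.
  have p := differentiable_pair (dh x Ux) (df x Ux).
  have scb : bilinear_for (GRing.Scale.Law.clone _ _ *:%R _)
      (GRing.Scale.Law.clone _ _ *:%R _) ( *:%R : R -> W -> W).
    by split=> [u'|u] a y z /=; rewrite ?scalerDl ?scalerDr !scalerA // mulrC.
  pose scM := bilinear_isBilinear.Build R R W W _ _ _ scb.
  pose scL : {bilinear R -> W -> W} := HB.pack ( *:%R : R -> W -> W) scM.
  have sc : continuous (fun p : R * W => scL p.1 p.2) := @scale_continuous R W.
  have bl := @differentiable_bilin R R W W scL (h x, f x) sc.
  rewrite -/((fun q : R * W => q.1 *: q.2) \o (fun x => (h x, f x))).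
  apply: DiffDef; first exact: differentiable_comp.
  rewrite diff_comp// (@diff_bilin _ _ _ _ scL)// diff_pair//; [|exact: dh|exact: df].
  by apply/funext => v /=; rewrite addrC.
split=> [x Ux|v]; first exact: (@ex_diff _ _ _ _ _ _ _ (key x Ux)).
have := CkD oU (IH _ _ (Ch' v) (CkW Cf)) (IH _ _ (CkW Ch) (Cf' v)).
apply: Ck_eq => // x Ux; have kx := key x Ux.
by rewrite (@diff_val _ _ _ _ _ _ _ kx).
Qed.

Lemma Ck_linl V W W' k (U : set V) (f : V -> W) (L : {linear W -> W'}) :
  open U -> continuous L -> Ck k U f -> Ck k U (fun x => L (f x)).
Proof.
move=> oU cL; elim: k f => [|k IH] f /=.
  by move=> cf x Ux; apply: continuous_comp; [exact: cf|exact: cL].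
move=> [df Cf]; have dL y := linear_differentiable y cL.
split=> [x Ux|v]; first by apply: differentiable_comp => //; exact: df.
apply: Ck_eq (IH _ (Cf v)) => // x Ux.
by rewrite (diff_compE f L) ?diff_linE//; exact: df.
Qed.

Lemma Ck_linr V V' W k (U : set V) (f : V -> W) (L : {linear V' -> V}) :
  open U -> continuous L -> Ck k U f -> Ck k (L @^-1` U) (fun x => f (L x)).
Proof.
move=> oU cL; have oLU : open (L @^-1` U) by move/continuousP : cL; apply.
elim: k f => [|k IH] f /=.
  by move=> cf x Ux; apply: continuous_comp; [exact: cL|exact: cf].
move=> [df Cf]; have dL y := linear_differentiable y cL.
split=> [x Ux|v]; first by apply: differentiable_comp => //; exact: df.
apply: Ck_eq (IH _ (Cf (L v))) => // x Ux.
by rewrite (diff_compE L f) ?diff_linE//; exact: df.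
Qed.

Lemma Ck_pair V W W' k (U : set V) (f : V -> W) (g : V -> W') : open U ->
  Ck k U f -> Ck k U g -> Ck k U (fun x => (f x, g x)).
Proof.
move=> oU; elim: k f g => [|k IH] f g /=.
  by move=> cf cg x Ux; apply: cvg_pair; [exact: cf|exact: cg].
move=> [df Cf] [dg Cg]; split=> [x Ux|v].
  by apply: differentiable_pair; [exact: df|exact: dg].
apply: Ck_eq (IH _ _ (Cf v) (Cg v)) => // x Ux.
by rewrite diff_pair//; [exact: df|exact: dg].
Qed.

Lemma diff_row W d (g : 'rV[R]_d -> W) (y w : 'rV[R]_d) :
  'd g y w = \sum_(j < d) w 0 j *: 'd g y (delta_mx 0 j).
Proof.
rewrite [in LHS](row_sum_delta w) linear_sum.
by apply: eq_bigr => j _; rewrite linearZ.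
Qed.

Lemma Ck_coord V d k (U : set V) (f : V -> 'rV[R]_d) j : open U ->
  Ck k U f -> Ck k U (fun x => f x 0 j : R).
Proof.
move=> oU.
have lc : linear (fun M : 'rV[R]_d => M 0 j : R) by move=> a x y; rewrite !mxE.
pose lM := GRing.isLinear.Build _ _ _ _ _ lc.
pose L : {linear 'rV[R]_d -> R} := HB.pack (fun M : 'rV[R]_d => M 0 j : R) lM.
by apply: (@Ck_linl _ _ _ _ _ _ L) => //; exact: coord_continuous.
Qed.

(** The directional derivative of g o f along v is x |-> 'd g (f x) ('d f x v),
    where both the point and the direction vary.  Expanding the direction in the
    basis of 'rV_d turns it into a sum of products of coordinates of 'd f x v with
    directional derivatives of g along fixed vectors composed with f; those are
    C^k by induction. *)
Lemma Ck_comp V W d k (U : set V) (U' : set 'rV[R]_d) (f : V -> 'rV[R]_d)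
    (g : 'rV[R]_d -> W) : open U -> open U' -> (forall x, U x -> U' (f x)) ->
  Ck k U f -> Ck k U' g -> Ck k U (fun x => g (f x)).
Proof.
move=> oU oU' UU'; elim: k f g UU' => [|k IH] f g UU' Cf Cg.
  by move=> x Ux; apply: continuous_comp; [exact: Cf|apply: Cg; exact: UU'].
have [df Cf'] := Cf; have [dg Cg'] := Cg.
split=> [x Ux|v].
  by apply: differentiable_comp; [exact: df|apply: dg; exact: UU'].
have : Ck k U (fun x => \sum_(j < d) 'd f x v 0 j *: 'd g (f x) (delta_mx 0 j)).
  apply: Ck_sum => // j; apply: CkZ => //; first exact: (Ck_coord _ _ (Cf' v)).
  apply: (IH f (fun y => 'd g y (delta_mx 0 j))) => //; first exact: CkW.
  exact: Cg'.
apply: Ck_eq => // x Ux; rewrite -diff_row.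
by rewrite (diff_compE f g)//; [exact: df|apply: dg; exact: UU'].
Qed.

Lemma smooth_diff V W (U : set V) (f : V -> W) x :
  smooth_on U f -> U x -> differentiable f x.
Proof. by move=> /(_ 1%N)[+ _]; exact. Qed.

End Ck.

Section matrix_calculus.
Variables (R : realType) (V : normedModType R).

Lemma differentiable_bigsum (W : normedModType R) (I : Type) (r : seq I)
    (F : I -> V -> W) x : (forall i, differentiable (F i) x) ->
  differentiable (fun y => \sum_(i <- r) F i y) x.
Proof.
move=> dF; elim: r => [|i r IH].
  by under eq_fun do rewrite big_nil; exact: differentiable_cst.
under eq_fun do rewrite big_cons.
exact: (differentiableD (dF i) IH).
Qed.

Lemma differentiable_bigprod (I : Type) (r : seq I) (F : I -> V -> R) x :
  (forall i, differentiable (F i) x) ->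
  differentiable (fun y => \prod_(i <- r) F i y) x.
Proof.
move=> dF; elim: r => [|i r IH].
  by under eq_fun do rewrite big_nil; exact: differentiable_cst.
under eq_fun do rewrite big_cons.
exact: (differentiableM (dF i) IH).
Qed.

Lemma differentiable_entry m n (f : V -> 'M[R]_(m, n)) x i j :
  differentiable f x -> differentiable (fun y => f y i j : R) x.
Proof.
move=> df; rewrite -/((fun M : 'M[R]_(m, n) => M i j : R) \o f).
by apply: differentiable_comp => //; exact: differentiable_coord.
Qed.

Lemma differentiable_det n (f : V -> 'M[R]_n) x :
  (forall i j, differentiable (fun y => f y i j : R) x) ->
  differentiable (fun y => \det (f y)) x.
Proof.
move=> df; apply: differentiable_bigsum => s.
exact: (@differentiableM _ _ (cst _) (fun y => \prod_i f y i (_ i)) x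
  (differentiable_cst _ _) (differentiable_bigprod _ _)).
Qed.

Lemma differentiable_mulmx m n p (f : V -> 'M[R]_(m, n)) (g : V -> 'M[R]_(n, p)) x :
  differentiable f x -> differentiable g x ->
  differentiable (fun y => f y *m g y) x.
Proof.
move=> df dg; apply: mx_differentiable => i j.
under eq_fun do rewrite mxE.
apply: differentiable_bigsum => k.
by apply: (@differentiableM _ _ (fun y => f y i k) (fun y => g y k j));
  exact: differentiable_entry.
Qed.

End matrix_calculus.

Section matrix_calculus_diff.
Variable R : realType.

Lemma mulmx_continuous m n p :
  continuous (fun q : 'M[R]_(m, n) * 'M[R]_(n, p) => q.1 *m q.2).
Proof.
move=> q; apply: differentiable_continuous; apply: differentiable_mulmx.
  by apply: (@linear_differentiable _ _ _ fst) => x; exact: cvg_fst.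
by apply: (@linear_differentiable _ _ _ snd) => x; exact: cvg_snd.
Qed.

Lemma diff_mulmx (V : normedModType R) m n p (f : V -> 'M[R]_(m, n))
    (g : V -> 'M[R]_(n, p)) x v :
  differentiable f x -> differentiable g x ->
  'd (fun y => f y *m g y) x v = f x *m 'd g x v + 'd f x v *m g x.
Proof.
move=> df dg; have cm := @mulmx_continuous m n p.
rewrite (diff_compE (fun y => (f y, g y)) (fun q => q.1 *m q.2)).
- by rewrite (@diff_bilin _ _ _ _ mulmx)//= diff_pair.
- exact: differentiable_pair.
- exact: (@differentiable_bilin _ _ _ _ mulmx).
Qed.

Lemma near_unitmx n (X : 'M[R]_n) :
  X \in unitmx -> \forall Y \near X, Y \in unitmx.
Proof.
rewrite unitmxE unitfE => dX0.
have /differentiable_continuous/cvgr_neq0/(_ dX0) :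
    differentiable (fun Y : 'M[R]_n => \det Y) X.
  by apply: differentiable_det => i j; exact: differentiable_coord.
by apply: filterS => Y; rewrite unitmxE unitfE.
Qed.

(** Near an invertible matrix the inverse is the adjugate divided by the
    determinant, both of which are polynomial in the entries. *)
Lemma differentiable_invmx n (X : 'M[R]_n) :
  X \in unitmx -> differentiable invmx X.
Proof.
move=> uX.
have dX0 : \det X != 0 by rewrite -unitfE -unitmxE.
have dadj : differentiable (fun Y : 'M[R]_n => \adj Y) X.
  apply: mx_differentiable => i j; under eq_fun do rewrite mxE.
  apply: (@differentiableM _ _ (cst ((-1) ^+ (j + i)))
    (fun Y : 'M[R]_n => \det (row' j (col' i Y)))) => //.
  apply: differentiable_det => k l; under eq_fun do rewrite !mxE.
  exact: differentiable_coord.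
have [] // := @near_eq_diff _ _ _ (fun Y => (\det Y)^-1 *: \adj Y) invmx X.
  by apply: filterS (near_unitmx uX) => Y uY; rewrite /invmx uY.
apply: mx_differentiable => i j; under eq_fun do rewrite mxE.
apply: (@differentiableM _ _ (fun Y : 'M[R]_n => (\det Y)^-1)
  (fun Y : 'M[R]_n => (\adj Y) i j)).
  have ddet : differentiable (fun Y : 'M[R]_n => \det Y) X.
    by apply: differentiable_det => k l; exact: differentiable_coord.
  exact: (differentiableV ddet dX0).
exact: differentiable_entry.
Qed.

(** Differentiate invmx Y *m Y = 1, which holds near X. *)
Lemma diff_invmx n (X H : 'M[R]_n) :
  X \in unitmx -> 'd invmx X H = - (invmx X *m H *m invmx X).
Proof.
move=> uX; have di := differentiable_invmx uX.
have near1 : \forall Y \near X, cst (1%:M : 'M[R]_n) Y = invmx Y *m Y.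
  by apply: filterS (near_unitmx uX) => Y uY /=; rewrite mulVmx.
have [_ d1] := near_eq_diff near1 (differentiable_cst _ _).
have cI : continuous (idfun : 'M[R]_n -> 'M[R]_n) by move=> x; exact: cvg_id.
have dI := linear_differentiable X cI.
have e1 : 'd (idfun : 'M[R]_n -> 'M[R]_n) X H = H := diff_linE X H cI.
have e0 : 'd (fun Y : 'M[R]_n => invmx Y *m Y) X H = 0.
  by rewrite [LHS](congr1 (fun h => h H) d1) (congr1 (fun h => h H) (diff_cst _ _)).
have e2 : 0 = invmx X *m H + 'd invmx X H *m X.
  by rewrite -[in X in X + _]e1 -e0; exact: diff_mulmx H di dI.
move/(congr1 (mulmx^~ (invmx X))) : e2; clear -uX.
rewrite mul0mx mulmxDl (mulmxK uX) => /eqP.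
by rewrite eq_sym addrC addr_eq0 => /eqP.
Qed.

End matrix_calculus_diff.

(** * Smooth maps between charted subsets *)

Section smooth_maps.
Variable R : realType.
Implicit Types (E F K : normedModType R).

Lemma open_preim (V W : normedModType R) (U : set V) (U' : set W) (f : V -> W) :
  open U -> open U' -> (forall x, U x -> {for x, continuous f}) ->
  open (U `&` f @^-1` U').
Proof.
move=> oU oU' cf; rewrite openE => x [Ux U'fx].
apply: filterI; first exact: open_nbhs_nbhs.
by apply: (cf x Ux); exact: open_nbhs_nbhs.
Qed.

(** The part of [immersed] that is needed of the target of a smooth map; unlike
    [immersed] it can be established for a product before smooth maps into that
    product are available. *)
Definition charts_inj E (S : submfd E) :=
  forall c, charts S c -> set_inj c.1 c.2.

Lemma immersed_inj E (S : submfd E) : immersed S -> charts_inj S.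
Proof. by move=> [H _ _] c /H[]. Qed.

(** Local expressions glue: as the charts of the target are injective, a local
    expression is determined by the map. *)
Lemma smooth_map_local E F (S : submfd E) (T : submfd F) (f : E -> F) :
  charts_inj T -> set_fun (pts S) (pts T) f ->
  (forall c c' u, charts S c -> charts T c' -> chart_dom c c' f u ->
    exists Q t, [/\ open Q, Q u, smooth_on Q t &
      forall y, Q y -> [/\ c.1 y, c'.1 (t y) & c'.2 (t y) = f (c.2 y)]]) ->
  smooth_map S T f.
Proof.
move=> injT fST loc; split=> // c c' Sc Tc'; split.
  rewrite openE => u /(loc _ _ _ Sc Tc')[Q [t [oQ Qu _ Qt]]].
  apply: filterS (open_nbhs_nbhs (conj oQ Qu)) => y /Qt[cy c't ft].
  by split=> //; exists (t y).
(* A total function that solves c'.2 v = f (c.2 u) wherever it is solvable. *)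
pose t u := xget 0 [set v | c'.1 v /\ c'.2 v = f (c.2 u)].
have tP u : chart_dom c c' f u -> c'.1 (t u) /\ c'.2 (t u) = f (c.2 u).
  by move=> [cu [v c'v vE]]; rewrite /t; case: xgetP => [//|/(_ v)]; case.
exists t; split=> //; apply: smooth_local => u /[dup] du.
move=> /(loc _ _ _ Sc Tc')[Q [t' [oQ Qu st' Qt']]].
exists Q, t'; split=> // y /Qt'[cy c't' ft'].
have [|c't ft] := tP y; first by split=> //; exists (t' y).
by apply: (injT c' Tc'); rewrite ?inE// ft' ft.
Qed.

(** Around a given point, an intermediate chart of T factors the expression of
    g o f through those of f and g. *)
Lemma smooth_map_comp E F K (S : submfd E) (T : submfd F) (U : submfd K) f g :
  immersed S -> immersed T -> charts_inj U ->
  smooth_map S T f -> smooth_map T U g -> smooth_map S U (fun x => g (f x)).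
Proof.
move=> [Sc _ _] [_ Tcov _] injU [fST sf] [gTU sg].
apply: smooth_map_local => // [x /fST/gTU//|c c'' u cS c''U].
move=> [cu [v c''v vE]].
have [_ _ _ cpts _] := Sc c cS.
have [c' [w [c'T c'w wE]]] := Tcov _ (fST _ (cpts _ cu)).
have [op1 [t1 [s1 H1]]] := sf c c' cS c'T.
have [op2 [t2 [s2 H2]]] := sg c' c'' c'T c''U.
have d1 : chart_dom c c' f u by split=> //; exists w.
have c1 y : chart_dom c c' f y -> {for y, continuous t1}.
  by move=> dy; apply: differentiable_continuous; exact: smooth_diff s1 dy.
exists (chart_dom c c' f `&` t1 @^-1` chart_dom c' c'' g), (t2 \o t1); split.
- exact: open_preim.
- split=> //; have [c't1 E1] := H1 u d1.
  by split=> //; exists v => //; rewrite vE E1.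
- move=> k; apply: (@Ck_comp _ _ _ _ _ _ (chart_dom c' c'' g)) => //.
  + exact: open_preim.
  + by move=> y [].
  + by apply: Ck_sub (s1 k) => y [].
- move=> y [dy1 dy2]; have [c't1 E1] := H1 y dy1.
  have [c''t2 E2] := H2 _ dy2.
  by split=> //=; [case: dy1|rewrite E2 E1].
Qed.

Lemma charts_inj_prod E F (S : submfd E) (T : submfd F) :
  charts_inj S -> charts_inj T -> charts_inj (prod_submfd S T).
Proof.
move=> iS iT _ [c1 [c2 [Sc1 Tc2 ->]]] x y /=; rewrite !inE => -[xl xr] [yl yr] [].
move=> /(iS _ Sc1); rewrite !inE => /(_ xl yl) el.
move=> /(iT _ Tc2); rewrite !inE => /(_ xr yr) er.
by rewrite -[x]hsubmxK -[y]hsubmxK el er.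
Qed.

Lemma lsub_cts d e : continuous (lsubmx : 'rV[R]_(d + e) -> 'rV[R]_d).
Proof. exact: linear_mx_continuous. Qed.

Lemma rsub_cts d e : continuous (rsubmx : 'rV[R]_(d + e) -> 'rV[R]_e).
Proof. exact: linear_mx_continuous. Qed.

Lemma open_lr d e (U : set 'rV[R]_d) (U' : set 'rV[R]_e) : open U -> open U' ->
  open [set w : 'rV[R]_(d + e) | U (lsubmx w) /\ U' (rsubmx w)].
Proof.
move=> oU oU'; apply: (@openI _ (lsubmx @^-1` U) (rsubmx @^-1` U')).
  by have /continuousP := @lsub_cts d e; exact.
by have /continuousP := @rsub_cts d e; exact.
Qed.

Lemma smooth_lsub (W : normedModType R) d e (U : set 'rV[R]_d)
    (U' : set 'rV[R]_e) (f : 'rV[R]_d -> W) : open U -> smooth_on U f ->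
  smooth_on [set w : 'rV[R]_(d + e) | U (lsubmx w) /\ U' (rsubmx w)]
    (fun w => f (lsubmx w)).
Proof.
move=> oU sf k; have := Ck_linr oU (@lsub_cts d e) (sf k).
by apply: Ck_sub => w [].
Qed.

Lemma smooth_rsub (W : normedModType R) d e (U : set 'rV[R]_d)
    (U' : set 'rV[R]_e) (f : 'rV[R]_e -> W) : open U' -> smooth_on U' f ->
  smooth_on [set w : 'rV[R]_(d + e) | U (lsubmx w) /\ U' (rsubmx w)]
    (fun w => f (rsubmx w)).
Proof.
move=> oU sf k; have := Ck_linr oU (@rsub_cts d e) (sf k).
by apply: Ck_sub => w [].
Qed.

Lemma smooth_row_mx (V : normedModType R) d e (U : set V)
    (f : V -> 'rV[R]_d) (g : V -> 'rV[R]_e) : open U ->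
  smooth_on U f -> smooth_on U g -> smooth_on U (fun x => row_mx (f x) (g x)).
Proof.
move=> oU sf sg k.
have Hf := Ck_linl (L := mulmxr (row_mx 1%:M (0 : 'M[R]_(d, e)))) oU
  (@linear_mx_continuous _ _ _ _ _) (sf k).
have Hg := Ck_linl (L := mulmxr (row_mx (0 : 'M[R]_(e, d)) 1%:M)) oU
  (@linear_mx_continuous _ _ _ _ _) (sg k).
apply: Ck_eq (CkD oU Hf Hg) => // x _ /=.
by rewrite !mul_mx_row !mulmx1 !mulmx0 add_row_mx addr0 add0r.
Qed.

Lemma smooth_map_fst E F (S : submfd E) (T : submfd F) :
  immersed S -> immersed T -> smooth_map (prod_submfd S T) S fst.
Proof.
move=> imS [Tc _ _]; have [Sc _ [_ sid]] := imS.
apply: smooth_map_local (immersed_inj imS) _ _ => [x []//|].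
move=> _ c' u [c1 [c2 [Sc1 Tc2 ->]]] Sc' [/= [ul ur] [v c'v vE]].
have [op1 [t1 [s1 H1]]] := sid c1 c' Sc1 Sc'.
have [op2 _ _ _ _] := Tc c2 Tc2.
exists [set w | chart_dom c1 c' id (lsubmx w) /\ c2.1 (rsubmx w)].
exists (fun w => t1 (lsubmx w)); split.
- exact: open_lr.
- by split=> //; split=> //; exists v.
- exact: smooth_lsub.
- by move=> y [/[dup] /H1[c't E1] [c1y _] c2y].
Qed.

Lemma smooth_map_snd E F (S : submfd E) (T : submfd F) :
  immersed S -> immersed T -> smooth_map (prod_submfd S T) T snd.
Proof.
move=> [Sc _ _] imT; have [Tc _ [_ sid]] := imT.
apply: smooth_map_local (immersed_inj imT) _ _ => [x []//|].
move=> _ c' u [c1 [c2 [Sc1 Tc2 ->]]] Tc' [/= [ul ur] [v c'v vE]].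
have [op1 [t1 [s1 H1]]] := sid c2 c' Tc2 Tc'.
have [op2 _ _ _ _] := Sc c1 Sc1.
exists [set w | c1.1 (lsubmx w) /\ chart_dom c2 c' id (rsubmx w)].
exists (fun w => t1 (rsubmx w)); split.
- exact: open_lr.
- by split=> //; split=> //; exists v.
- exact: smooth_rsub.
- by move=> y [c1y /[dup] /H1[c't E1] [c2y _]].
Qed.

Lemma smooth_map_pair E F K (S : submfd E) (T : submfd F) (U : submfd K)
    (f : E -> F) (g : E -> K) : charts_inj T -> charts_inj U ->
  smooth_map S T f -> smooth_map S U g ->
  smooth_map S (prod_submfd T U) (fun x => (f x, g x)).
Proof.
move=> iT iU [fST sf] [gSU sg].
apply: smooth_map_local; first exact: charts_inj_prod.
  by move=> x Sx; split; [exact: fST|exact: gSU].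
move=> c _ u Sc [c1 [c2 [Tc1 Uc2 ->]]] [/= cu [v [vl vr] [fE gE]]].
have [op1 [t1 [s1 H1]]] := sf c c1 Sc Tc1.
have [op2 [t2 [s2 H2]]] := sg c c2 Sc Uc2.
have op12 := openI op1 op2.
exists (chart_dom c c1 f `&` chart_dom c c2 g).
exists (fun w => row_mx (t1 w) (t2 w)); split=> //.
- by split; (split=> //); [exists (lsubmx v)|exists (rsubmx v)].
- apply: smooth_row_mx => //= k; first by apply: Ck_sub (s1 k) => y [].
  by apply: Ck_sub (s2 k) => y [].
- move=> y [/[dup] /H1[c1t E1] [cy _] /H2[c2t E2]].
  by rewrite row_mxKl row_mxKr E1 E2.
Qed.

Lemma smooth_chart_prod_diff E F (S : submfd E) (T : submfd F) c1 c2
    (w h : 'rV[R]_(mdim S + mdim T)) : immersed S -> immersed T ->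
  charts S c1 -> charts T c2 -> c1.1 (lsubmx w) -> c2.1 (rsubmx w) ->
  'd (fun w => (c1.2 (lsubmx w), c2.2 (rsubmx w)) : E * F) w h =
  ('d (c1.2) (lsubmx w) (lsubmx h), 'd (c2.2) (rsubmx w) (rsubmx h)).
Proof.
move=> [Sc _ _] [Tc _ _] Sc1 Tc2 wl wr.
have [op1 s1 _ _ _] := Sc _ Sc1; have [op2 s2 _ _ _] := Tc _ Tc2.
have d1 := smooth_diff s1 wl; have d2 := smooth_diff s2 wr.
have dl : differentiable (lsubmx : 'rV[R]_(mdim S + mdim T) -> _) w.
  exact: differentiable_lsubmx.
have dr : differentiable (rsubmx : 'rV[R]_(mdim S + mdim T) -> _) w.
  exact: differentiable_rsubmx.
rewrite diff_pair; [|exact: (differentiable_comp dl d1)|exact: (differentiable_comp dr d2)].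
rewrite (diff_compE lsubmx c1.2)// (diff_compE rsubmx c2.2)//.
by rewrite !diff_linE//; [exact: rsub_cts|exact: lsub_cts].
Qed.

(** The changes of charts of the product are smooth because the identity is the
    pair of the two projections. *)
Lemma immersed_prod E F (S : submfd E) (T : submfd F) :
  immersed S -> immersed T -> immersed (prod_submfd S T).
Proof.
move=> imS imT; have [Sc Scov _] := imS; have [Tc Tcov _] := imT; split.
- move=> _ [c1 [c2 [Sc1 Tc2 ->]]] /=.
  have [op1 s1 i1 p1 d1] := Sc _ Sc1; have [op2 s2 i2 p2 d2] := Tc _ Tc2.
  have op12 := open_lr op1 op2; split=> //.
  + move=> k; apply: Ck_pair => //; first exact: smooth_lsub.
    exact: smooth_rsub.
  + apply: (charts_inj_prod (immersed_inj imS) (immersed_inj imT)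
      (c := (_, fun w => (c1.2 (lsubmx w), c2.2 (rsubmx w))))).
    by exists c1, c2.
  + by move=> w [wl wr]; split; [exact: p1|exact: p2].
  + move=> w [wl wr] x y; rewrite !(smooth_chart_prod_diff _ imS imT)// => -[].
    by move=> /(d1 _ wl) el /(d2 _ wr) er; rewrite -[x]hsubmxK -[y]hsubmxK el er.
- move=> [x y] [/= /Scov[c1 [u [Sc1 cu <-]]] /Tcov[c2 [v [Tc2 cv <-]]]].
  exists ([set w | c1.1 (lsubmx w) /\ c2.1 (rsubmx w)],
     fun w => (c1.2 (lsubmx w), c2.2 (rsubmx w))), (row_mx u v).
  by rewrite /= row_mxKl row_mxKr; split=> //; exists c1, c2.
- rewrite (_ : id = fun x : E * F => (x.1, x.2)); last by apply/funext => -[].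
  by apply: smooth_map_pair; [exact: immersed_inj|exact: immersed_inj|
    exact: smooth_map_fst|exact: smooth_map_snd].
Qed.

Lemma smooth_map_diag E F (S : submfd E) (T : submfd F) f :
  smooth_map S T f -> smooth_map S (diag_submfd T) (fun x => (f x, f x)).
Proof.
move=> [fST sf]; split=> [x Sx|c _ Sc [c1 Tc1 ->]].
  by split=> //; exact: fST.
have -> : chart_dom c (c1.1, fun u => (c1.2 u, c1.2 u)) (fun x => (f x, f x)) =
    chart_dom c c1 f.
  apply/seteqP; split=> u [cu [v cv]] /=; first by move=> [E1]; split=> //; exists v.
  by move=> E1; split=> //; exists v => //=; rewrite E1.
have [op [t [st H]]] := sf c c1 Sc Tc1; split=> //; exists t; split=> // u /H[].
by move=> ? /= ->.
Qed.

Lemma diag_smooth_map E F (S : submfd E) (T : submfd F) f :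
  smooth_map S T f -> smooth_map (diag_submfd S) T (fun x => f x.1).
Proof.
move=> [fST sf]; split=> [x [Sx _]|_ c' [c1 Sc1 ->] Tc']; first exact: fST.
exact: sf.
Qed.

Lemma chart_diag_diff E (S : submfd E) c u h : immersed S -> charts S c ->
  c.1 u -> 'd (fun u => (c.2 u, c.2 u) : E * E) u h = ('d (c.2) u h, 'd (c.2) u h).
Proof.
move=> [Sc _ _] cS cu; have [_ s1 _ _ _] := Sc _ cS.
by have d1 := smooth_diff s1 cu; rewrite diff_pair.
Qed.

(** The diagonal has the charts of S, hence the same changes of charts. *)
Lemma immersed_diag E (S : submfd E) : immersed S -> immersed (diag_submfd S).
Proof.
move=> imS; have [Sc Scov sid] := imS; split.
- move=> _ [c cS ->] /=; have [op s i p d] := Sc _ cS; split=> //.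
  + by move=> k; apply: Ck_pair.
  + by move=> x y cx cy [xy _]; exact: i.
  + by move=> u /p.
  + by move=> u cu x y; rewrite !(chart_diag_diff _ imS)// => -[xy _]; exact: (d u).
- move=> [x y] /= [/Scov[c [u [cS cu <-]]] ->].
  by exists (c.1, fun u => (c.2 u, c.2 u)), u; split=> //; exists c.
- have [_ H] := smooth_map_diag (diag_smooth_map sid); split=> // c c' Sc1 Sc'.
  have [op [t [st Ht]]] := H c c' Sc1 Sc'.
  have E1 : chart_dom c c' (fun x => (id x.1, id x.1)) = chart_dom c c' id.
    case: Sc1 => c1 _ ->; by [].
  rewrite -E1; split=> //; exists t; split=> // u /Ht.
  by case: Sc1 => c1 _ ->.
Qed.

End smooth_maps.

(** * Tangent spaces *)

Section tangent_spaces.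
Variable R : realType.
Implicit Types (E F K : normedModType R).

Lemma chart_diff E (S : submfd E) c u :
  immersed S -> charts S c -> c.1 u -> differentiable c.2 u.
Proof. by move=> [Sc _ _] /Sc[_ s _ _ _]; exact: smooth_diff. Qed.

(** Differentiate f o c = c' o t, where t is the expression of f in the charts c
    and c'. *)
Lemma tangent_map_chart E F (S : submfd E) (T : submfd F) f c u c' u' w :
  immersed S -> immersed T -> smooth_map S T f ->
  charts S c -> c.1 u -> charts T c' -> c'.1 u' -> c'.2 u' = f (c.2 u) ->
  differentiable f (c.2 u) ->
  exists w', 'd f (c.2 u) ('d (c.2) u w) = 'd (c'.2) u' w'.
Proof.
move=> imS imT [_ sf] Sc cu Tc' cu' fE df.
have [op [t [st H]]] := sf c c' Sc Tc'.
have du : chart_dom c c' f u by split=> //; exists u'.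
have tu : t u = u'.
  have [c't ft] := H _ du.
  by apply: (immersed_inj imT Tc'); rewrite ?inE// ft.
have dt := smooth_diff st du.
have dc := chart_diff imS Sc cu.
have dc' : differentiable c'.2 (t u) by rewrite tu; exact: chart_diff imT Tc' cu'.
have near_eq : \forall y \near u, f (c.2 y) = c'.2 (t y).
  apply: filterS (open_nbhs_nbhs (conj op du)) => y dy.
  by have [_ ->] := H y dy.
have [_ e] := near_eq_diff near_eq (differentiable_comp dc df).
exists ('d t u w); rewrite -tu -(diff_compE c.2 f)//.
by rewrite -(diff_compE t c'.2)// e.
Qed.

Lemma tangent_pts E (S : submfd E) x v : immersed S -> tangent S x v -> pts S x.
Proof.
by move=> [Sc _ _] [c [u [w [/Sc[_ _ _ p _] cu <- _]]]]; exact: p.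
Qed.

Lemma tangent_map E F (S : submfd E) (T : submfd F) f x v :
  immersed S -> immersed T -> smooth_map S T f -> differentiable f x ->
  tangent S x v -> tangent T (f x) ('d f x v).
Proof.
move=> imS imT sf df tv; have Sx := tangent_pts imS tv.
have [_ Tcov _] := imT; have [fST _] := sf.
have [c' [u' [Tc' cu' E']]] := Tcov _ (fST _ Sx).
case: tv df E' => c [u [w [Sc cu <- ->]]] df E'.
have [w' ->] := tangent_map_chart w imS imT sf Sc cu Tc' cu' E' df.
by exists c', u', w'.
Qed.

Lemma id_differentiable E (x : E) : differentiable id x.
Proof. by apply: (@linear_differentiable _ _ _ idfun) => y; exact: cvg_id. Qed.

Lemma diff_idE E (x v : E) : 'd id x v = v.
Proof. by apply: (@diff_linE _ _ _ idfun) => y; exact: cvg_id. Qed.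

(** One chart is enough to describe the tangent space, although [tangent] lets the
    chart vary: apply [tangent_map_chart] to the identity. *)
Lemma tangent_range E (S : submfd E) c u : immersed S -> charts S c -> c.1 u ->
  tangent S (c.2 u) = range ('d (c.2) u).
Proof.
move=> imS Sc cu; apply/seteqP; split=> v; last first.
  by move=> [w _ <-]; exists c, u, w.
move=> [c' [u' [w' [Sc' cu' E' ->]]]]; have [_ _ sid] := imS.
have [|w] := tangent_map_chart w' imS imS sid Sc' cu' Sc cu (esym E').
  exact: id_differentiable.
move=> e; exists w; first exact: I.
exact: etrans (esym e) (diff_idE _ _).
Qed.

(** The form in which it is used that a tangent space is a finite-dimensional
    linear subspace. *)
Lemma tangent_param E (S : submfd E) x : immersed S -> pts S x ->
  exists d (L : {linear 'rV[R]_d -> E}), injective L /\ tangent S x = range L.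
Proof.
move=> imS Sx; have [Sc Scov _] := imS.
have [c [u [cS cu <-]]] := Scov _ Sx.
exists (mdim S), ('d (c.2) u); split; last exact: tangent_range.
by have [_ _ _ _] := Sc c cS; exact.
Qed.

(** Only the values on S matter along tangent directions; this is how identities
    between functions on a group are differentiated. *)
Lemma tangent_eq_diff E F (S : submfd E) (f g : E -> F) x v : immersed S ->
  (forall y, pts S y -> f y = g y) -> differentiable f x -> differentiable g x ->
  tangent S x v -> 'd f x v = 'd g x v.
Proof.
move=> imS fg df dg; have [Sc _ _] := imS.
case=> c [u [w [cS cu E1 ->]]]; move: df dg; rewrite -E1 => df dg.
have [op _ _ p _] := Sc _ cS; have dc := chart_diff imS cS cu.
rewrite -(diff_compE c.2 f)// -(diff_compE c.2 g)//.
have near_eq : \forall y \near u, f (c.2 y) = g (c.2 y).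
  by apply: filterS (open_nbhs_nbhs (conj op cu)) => y cy; apply: fg; exact: p.
by have [_ ->] := near_eq_diff near_eq (differentiable_comp dc df).
Qed.

Lemma tangent_prod E F (S : submfd E) (T : submfd F) x y :
  immersed S -> immersed T ->
  tangent (prod_submfd S T) (x, y) = tangent S x `*` tangent T y.
Proof.
move=> imS imT; apply/seteqP; split=> [z|[v1 v2]].
  move=> [_ [w [h [[c1 [c2 [Sc1 Tc2 ->]]] /= [wl wr] [<- <-] ->]]]].
  rewrite (smooth_chart_prod_diff _ imS imT)//.
  by split=> /=; [exists c1, (lsubmx w), (lsubmx h)|
                  exists c2, (rsubmx w), (rsubmx h)].
move=> [/= [c1 [u1 [w1 [Sc1 cu1 <- ->]]]] [c2 [u2 [w2 [Sc2 cu2 <- ->]]]]].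
exists ([set w | c1.1 (lsubmx w) /\ c2.1 (rsubmx w)],
     fun w => (c1.2 (lsubmx w), c2.2 (rsubmx w))), (row_mx u1 u2), (row_mx w1 w2).
split=> /=; first by exists c1, c2.
- by rewrite row_mxKl row_mxKr.
- by rewrite row_mxKl row_mxKr.
- by rewrite (smooth_chart_prod_diff _ imS imT)// ?(row_mxKl, row_mxKr).
Qed.

Lemma tangent_diag E (S : submfd E) x : immersed S ->
  tangent (diag_submfd S) (x, x) = [set z | tangent S x z.1 /\ z.2 = z.1].
Proof.
move=> imS; apply/seteqP; split=> [z|[v1 v2]].
  move=> [_ [u [h [[c1 Sc1 ->] /= cu [<- _] ->]]]].
  by rewrite (chart_diag_diff _ imS)//; split=> //=; exists c1, u, h.
move=> [/= [c1 [u1 [w1 [Sc1 cu1 <- ->]]]] ->].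
exists (c1.1, fun u => (c1.2 u, c1.2 u)), u1, w1.
split=> //=; first by exists c1.
by rewrite (chart_diag_diff _ imS).
Qed.

End tangent_spaces.

(** * Lie groups and infinitesimal invariance *)

Section differentials.
Variable R : realType.
Implicit Types (U V W : normedModType R).

Lemma is_diffE V W (f df : V -> W) x v : is_diff x f df -> 'd f x v = df v.
Proof. by move=> D; rewrite (@diff_val _ _ _ _ _ _ _ D). Qed.

Lemma is_diff_linear V W (L : {linear V -> W}) x :
  continuous L -> is_diff x L L.
Proof.
move=> cL; apply: DiffDef; first exact: linear_differentiable.
exact: diff_lin.
Qed.

Lemma is_diff_idf V (x : V) : is_diff x (fun y => y) (fun v => v).
Proof. by apply: (@is_diff_linear V V idfun) => y; exact: cvg_id. Qed.

Lemma is_diff_fst V W (x : V * W) : is_diff x fst fst.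
Proof. by apply: (@is_diff_linear _ _ fst) => y; exact: cvg_fst. Qed.

Lemma is_diff_snd V W (x : V * W) : is_diff x snd snd.
Proof. by apply: (@is_diff_linear _ _ snd) => y; exact: cvg_snd. Qed.

Lemma is_diff_const V W (a : W) (x : V) : is_diff x (fun=> a) (fun=> 0).
Proof. exact: is_diff_cst. Qed.

Lemma is_diff_mulmx V m n p (f df : V -> 'M[R]_(m, n)) (g dg : V -> 'M[R]_(n, p)) x :
  is_diff x f df -> is_diff x g dg ->
  is_diff x (fun y => f y *m g y) (fun v => f x *m dg v + df v *m g x).
Proof.
move=> Df Dg; apply: DiffDef; first exact: differentiable_mulmx.
by apply/funext => v; rewrite diff_mulmx ?(is_diffE _ Df) ?(is_diffE _ Dg).
Qed.

Lemma is_diff_invmx V n (f df : V -> 'M[R]_n) x : f x \in unitmx ->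
  is_diff x f df ->
  is_diff x (fun y => invmx (f y)) (fun v => - (invmx (f x) *m df v *m invmx (f x))).
Proof.
move=> uf Df; have df0 : differentiable f x by exact: ex_diff.
have di := differentiable_invmx uf.
apply: DiffDef; first exact: (differentiable_comp df0 di).
apply/funext => v; rewrite (diff_compE f invmx)//.
by rewrite (is_diffE _ Df) diff_invmx.
Qed.

Lemma is_diff_linc U V W (L : {linear V -> W}) (f df : U -> V) x : continuous L ->
  is_diff x f df -> is_diff x (fun y => L (f y)) (fun v => L (df v)).
Proof. by move=> cL Df; apply: is_diff_comp (is_diff_linear _ cL). Qed.

Lemma tangent_is_diff V W (S : submfd V) (f g df dg : V -> W) x v :
  immersed S -> tangent S x v -> is_diff x f df -> is_diff x g dg ->
  (forall y, pts S y -> f y = g y) -> df v = dg v.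
Proof.
move=> imS tv Df Dg fg; rewrite -(is_diffE v Df) -(is_diffE v Dg).
by apply: (@tangent_eq_diff _ _ _ S) => //; exact: ex_diff.
Qed.

End differentials.

Section lie_groups.
Variable R : realType.
Implicit Types (E F : normedModType R).

Lemma lie_group_closed E (o : gops E) (G : submfd E) x y :
  lie_group o G -> pts G x -> pts G y -> pts G (gmul o x y).
Proof. by move=> [_ _ _ [mG _] _] Gx Gy; exact: (mG (x, y)). Qed.

Lemma lie_group_inv E (o : gops E) (G : submfd E) x :
  lie_group o G -> pts G x -> pts G (ginv o x).
Proof. by move=> [_ _ _ _ [vG _]] Gx; exact: vG. Qed.

(** The product multiplication shuffles the four factors and then applies the two
    multiplications. *)
Lemma lie_group_prod E F (o : gops E) (o' : gops F) (G : submfd E)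
    (H : submfd F) : lie_group o G -> lie_group o' H ->
  lie_group (prod_ops o o') (prod_submfd G H).
Proof.
move=> LG LH; have [imG G1 [GA G1m GV] mG vG] := LG.
have [imH H1 [HA H1m HV] mH vH] := LH.
have imP := immersed_prod imG imH; have imPP := immersed_prod imP imP.
have iG := immersed_inj imG; have iH := immersed_inj imH.
have imGG := immersed_prod imG imG; have imHH := immersed_prod imH imH.
have f1 := smooth_map_fst imP imP; have f2 := smooth_map_snd imP imP.
have g1 := smooth_map_fst imG imH; have g2 := smooth_map_snd imG imH.
split=> //.
- split=> [x y z [Gx Hx] [Gy Hy] [Gz Hz]|[x1 x2] [Gx Hx]|x [Gx Hx]] /=.
  + by rewrite GA// HA.
  + by rewrite G1m// H1m.
  + by rewrite GV// HV.
- apply: smooth_map_pair => //.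
  + apply: (@smooth_map_comp _ _ _ _ _ (prod_submfd G G) _
      (fun z : (E * F) * (E * F) => (z.1.1, z.2.1))
      (fun z => gmul o z.1 z.2)) => //.
    apply: smooth_map_pair => //.
      exact: (smooth_map_comp imPP imP iG f1 g1).
    exact: (smooth_map_comp imPP imP iG f2 g1).
  + apply: (@smooth_map_comp _ _ _ _ _ (prod_submfd H H) _
      (fun z : (E * F) * (E * F) => (z.1.2, z.2.2))
      (fun z => gmul o' z.1 z.2)) => //.
    apply: smooth_map_pair => //.
      exact: (smooth_map_comp imPP imP iH f1 g2).
    exact: (smooth_map_comp imPP imP iH f2 g2).
- apply: smooth_map_pair => //.
    exact: (smooth_map_comp imP imG iG g1 vG).
  exact: (smooth_map_comp imP imH iH g2 vH).
Qed.

Lemma smooth_map_eq E F (S : submfd E) (T : submfd F) f g :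
  immersed S -> (forall x, pts S x -> f x = g x) ->
  smooth_map S T f -> smooth_map S T g.
Proof.
move=> [Sc _ _] fg [fST sf]; split=> [x Sx|c c' cS cT]; first by rewrite -fg//; exact: fST.
have [_ _ _ p _] := Sc c cS.
have -> : chart_dom c c' g = chart_dom c c' f.
  by apply/seteqP; split=> u [cu [v cv vE]]; split=> //; exists v => //;
    rewrite vE fg//; exact: p.
have [op [t [st H]]] := sf c c' cS cT.
split=> //; exists t; split=> // u du; have [ct tE] := H u du.
by split=> //; rewrite tE fg//; apply: p; case: du.
Qed.

Lemma lie_group_diag E (o : gops E) (H : submfd E) :
  lie_group o H -> lie_group (prod_ops o o) (diag_submfd H).
Proof.
move=> LH; have [imH H1 [HA H1m HV] mH vH] := LH.
have imD := immersed_diag imH; have imDD := immersed_prod imD imD.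
have iH := immersed_inj imH; have imHH := immersed_prod imH imH.
have f1 := smooth_map_fst imD imD; have f2 := smooth_map_snd imD imD.
have [_ _ sid] := imH; have g1 := diag_smooth_map sid.
split=> //.
- split=> [[x ?] [y ?] [z ?] [/= Hx ->] [/= Hy ->] [/= Hz ->]|[x ?] [/= Hx ->]|[x ?] [/= Hx ->]] /=.
  + by rewrite HA.
  + by rewrite H1m.
  + by rewrite HV.
- apply: (@smooth_map_eq _ _ _ _
    (fun z => (gmul o z.1.1 z.2.1, gmul o z.1.1 z.2.1))) => //.
    by move=> x [[_ /= ->] [_ /= ->]].
  apply: smooth_map_diag.
  apply: (@smooth_map_comp _ _ _ _ _ (prod_submfd H H) _
      (fun z : (E * E) * (E * E) => (z.1.1, z.2.1))
      (fun z => gmul o z.1 z.2)) => //.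
  apply: smooth_map_pair => //.
    exact: (smooth_map_comp imDD imD iH f1 g1).
  exact: (smooth_map_comp imDD imD iH f2 g1).
- apply: (@smooth_map_eq _ _ _ _ (fun z => (ginv o z.1, ginv o z.1))) => //.
    by move=> x [_ /= ->].
  by apply: smooth_map_diag; exact: diag_smooth_map vH.
Qed.

(** The inclusion is X |-> (X, X) read through the smooth inclusion of H in G. *)
Lemma lie_subgroup_diag E (o : gops E) (H G : submfd E) :
  lie_group o G -> lie_subgroup o H G ->
  lie_subgroup (prod_ops o o) (diag_submfd H) (prod_submfd G H).
Proof.
move=> [imG _ _ _ _] [LH HG iHG]; have [imH _ _ _ _] := LH.
have [_ _ sid] := imH; split.
- exact: lie_group_diag.
- by move=> [x y] /= [Hx ->]; split=> //; exact: HG.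
- apply: (@smooth_map_eq _ _ _ _ (fun z => (z.1, z.1))).
  + exact: immersed_diag.
  + by move=> [x y] [_ /= ->].
  + exact: (smooth_map_pair (immersed_inj imG) (immersed_inj imH)
      (diag_smooth_map iHG) (diag_smooth_map sid)).
Qed.

End lie_groups.

Section linear_extension.
Variables (R : realType) (N : nat).

(** A linear projection onto the subspace extends any map that is linear on the
    subspace only. *)
Lemma range_projection d (L : {linear 'rV[R]_d -> 'M[R]_N}) :
  exists pr : {linear 'M[R]_N -> 'M[R]_N},
    (forall x, range L (pr x)) /\ (forall x, range L x -> pr x = x).
Proof.
pose U := limg (linfun L).
have UE x : (x \in U) <-> range L x.
  split; first by move=> /memv_imgP[w _ ->]; exists w => //; rewrite lfunE.
  by move=> [w _ <-]; apply/memv_imgP; exists w; rewrite ?memvf ?lfunE.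
exists (projv U); split=> x; first by apply/UE; exact: memv_proj.
by move=> /UE; exact: projv_id.
Qed.

End linear_extension.

Section matrix_lie_groups.
Variables (R : realType) (N : nat) (H : submfd 'M[R]_N).
Hypothesis mH : matrix_lie_group H.
Let o := GL_ops R N.
Let h := lie_algebra o H.

Let LH : lie_group o H. Proof. by case: mH. Qed.
Let imH : immersed H. Proof. by case: LH. Qed.

Lemma mlg_unit x : pts H x -> x \in unitmx.
Proof. by case: mH => _; exact. Qed.

Lemma mlg1 : pts H 1%:M.
Proof. by case: LH. Qed.

Lemma mlgV x : pts H x -> pts H (invmx x).
Proof. exact: (lie_group_inv LH). Qed.

Lemma tangent_param_mlg x : pts H x ->
  exists d (L : {linear 'rV[R]_d -> 'M[R]_N}), injective L /\ tangent H x = range L.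
Proof. exact: tangent_param. Qed.

Lemma tangent0 x : pts H x -> tangent H x 0.
Proof.
by move=> /tangent_param_mlg[d [L [_ ->]]]; exists 0 => //; exact: linear0.
Qed.

(** The differential of the product at (x, y); applied with a zero vector on one
    side, it says that translations preserve tangency. *)
Lemma tangent_mul x y v w : tangent H x v -> tangent H y w ->
  tangent H (x *m y) (x *m w + v *m y).
Proof.
move=> tv tw; have [_ _ _ sm _] := LH.
have imHH := immersed_prod imH imH.
have D := is_diff_mulmx (is_diff_fst (x, y)) (is_diff_snd (x, y)).
have : tangent (prod_submfd H H) (x, y) (v, w) by rewrite tangent_prod.
move=> /(tangent_map imHH imH sm (@ex_diff _ _ _ _ _ _ _ D)).
by rewrite /= (is_diffE _ D).
Qed.

Lemma tangent_mull x y v : pts H x -> tangent H y v ->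
  tangent H (x *m y) (x *m v).
Proof.
move=> /tangent0 t0 tv; have := tangent_mul t0 tv.
by rewrite mul0mx addr0.
Qed.

Lemma tangent_mulr x y v : pts H y -> tangent H x v ->
  tangent H (x *m y) (v *m y).
Proof.
move=> /tangent0 t0 tv; have := tangent_mul tv t0.
by rewrite mulmx0 add0r.
Qed.

(** Left translation by x^-1, and by x for the converse. *)
Lemma tangentE x v : pts H x -> tangent H x v <-> h (invmx x *m v).
Proof.
move=> Hx; have ux := mlg_unit Hx; split=> [tv|hv].
  by have := tangent_mull (mlgV Hx) tv; rewrite mulVmx.
by have := tangent_mull Hx hv; rewrite mulKVmx//= mulmx1.
Qed.

Lemma Ad_closed x v : pts H x -> h v -> h (x *m v *m invmx x).
Proof.
move=> Hx hv; have ux := mlg_unit Hx.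
by have := tangent_mulr (mlgV Hx) (tangent_mull Hx hv); rewrite /= mulmx1 mulmxV.
Qed.

Lemma is_diff_Ad v : is_diff (1%:M : 'M[R]_N)
  (fun X : 'M[R]_N => X *m v *m invmx X) (fun x => x *m v - v *m x).
Proof.
have D1 := is_diff_idf (1%:M : 'M[R]_N).
have := is_diff_mulmx (is_diff_mulmx D1 (is_diff_const v _))
  (@is_diff_invmx _ _ _ (fun X => X) _ _ (unitmx1 R N) D1).
congr (is_diff_def _ _); apply/funext => x.
by rewrite invmx1 mulmx0 add0r !mul1mx !mulmx1 mulmxN addrC.
Qed.

Lemma is_diff_AdV v : is_diff (1%:M : 'M[R]_N)
  (fun X : 'M[R]_N => invmx X *m v *m X) (fun x => v *m x - x *m v).
Proof.
have D1 := is_diff_idf (1%:M : 'M[R]_N).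
have := is_diff_mulmx (is_diff_mulmx (@is_diff_invmx _ _ _ (fun X => X) _ _ (unitmx1 R N) D1)
  (is_diff_const v _)) D1.
congr (is_diff_def _ _); apply/funext => x.
by rewrite invmx1 mulmx0 add0r !mul1mx !mulmx1 mulNmx.
Qed.

(** Let pr be a linear projection onto the Lie algebra h.  Since Ad_X preserves h,
    the maps X |-> pr (Ad_X y) and X |-> Ad_X y agree on H, hence so do their
    differentials at 1, and the bracket is fixed by pr. *)
Lemma bracket_closed x y : h x -> h y -> h (x *m y - y *m x).
Proof.
move=> hx hy; have [d [L [_ hE]]] := tangent_param_mlg mlg1.
have [pr [prh prid]] := range_projection L.
have cpr : continuous pr by exact: linear_mx_continuous.
have D := is_diff_Ad y; have Dp := is_diff_linc cpr D.
have e : pr (x *m y - y *m x) = x *m y - y *m x.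
  apply: (tangent_is_diff imH hx Dp D) => X HX.
  by apply: prid; rewrite -hE; exact: Ad_closed.
rewrite /h /lie_algebra/= hE -e; exact: prh.
Qed.

(** Differentiate b (Ad_X y) z = b y (Ad_{X^-1} z) at X = 1 along x.  In this
    shape each side is a linear functional of Ad, so only the continuity of linear
    functionals is needed; [b] is extended by the projection pr, being linear on
    the Lie algebra only. *)
Lemma bracket_invariant b x y z : sym_form h b -> bi_invariant o H b ->
  h x -> h y -> h z -> b (x *m y - y *m x) z = b (z *m x - x *m z) y.
Proof.
move=> [bC bl] bi hx hy hz; have [d [L [_ hE]]] := tangent_param_mlg mlg1.
have {}hE : h = range L by [].
have [pr [prh prid]] := range_projection L; rewrite -hE in prh prid.
have lb w : h w -> linear (fun x => b (pr x) w : R).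
  by move=> hw k u v; rewrite linearP bl.
pose phi w (hw : h w) : {linear 'M[R]_N -> R} :=
  HB.pack (fun x => b (pr x) w : R) (GRing.isLinear.Build _ _ _ _ _ (lb w hw)).
have cphi w (hw : h w) : continuous (phi w hw) by exact: linear_mx_continuous.
have DA := is_diff_linc (cphi z hz) (is_diff_Ad y).
have DV := is_diff_linc (cphi y hy) (is_diff_AdV z).
(* The brackets are already in h, where pr is the identity. *)
suff : b (pr (x *m y - y *m x)) z = b (pr (z *m x - x *m z)) y.
  by rewrite !prid//; exact: bracket_closed.
apply: (tangent_is_diff imH hx DA DV) => X HX /=; have uX := mlg_unit HX.
have hzX : h (invmx X *m z *m X).
  by have := Ad_closed (mlgV HX) hz; rewrite invmxK.
rewrite !prid//; last exact: Ad_closed.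
rewrite [RHS]bC// -[RHS](bi X)// /Ad/=.
by congr b; rewrite !mulmxA mulmxV// mul1mx mulmxK.
Qed.

End matrix_lie_groups.

(** * Linear algebra of the metric *)

(* Matrices form a module, not a field: identities between linear combinations
   are checked entrywise. *)
Ltac mxfield := apply/matrixP => ? ?; rewrite !mxE; field.

Section linear_rules.
Variables (R : realType) (N : nat) (L : {linear 'M[R]_N -> 'M[R]_N}).
Lemma linop_add x y : L (x + y) = L x + L y. Proof. exact: linearD. Qed.
Lemma linop_opp x : L (- x) = - L x. Proof. exact: linearN. Qed.
Lemma linop_scale k x : L (k *: x) = k *: L x. Proof. exact: linearZ. Qed.
End linear_rules.

(** [g] and [a] stand for the Lie algebra and the subalgebra, [f] for the form,
    [P] for the orthogonal projection on [a], [S] for the inverse of [B] on [a] and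
    [t] for beta0.  The form and the operators are linear everywhere; [md_fPz],
    without a condition on x, is the orthogonality of [P]. *)
Record metric_data (R : realType) (N : nat) (g a : set 'M[R]_N)
    (f : 'M[R]_N -> 'M[R]_N -> R) (P B S : {linear 'M[R]_N -> 'M[R]_N})
    (t : R) : Prop := MetricData {
  md_fC : forall x y, f x y = f y x;
  md_fP : forall k x y z, f (k *: x + y) z = k * f x z + f y z;
  md_gP : forall k x y, g x -> g y -> g (k *: x + y);
  md_ag : a `<=` g;
  md_Pa : forall x, a (P x);
  md_Pid : forall x, a x -> P x = x;
  md_fPz : forall x z, a z -> f x z = f (P x) z;
  md_Ba : forall x, a (B x);
  md_Sa : forall x, a (S x);
  md_BS : forall x, a x -> B (S x) = x;
  md_SB : forall x, a x -> S (B x) = x;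
  md_Bsym : forall x y, a x -> a y -> f (B x) y = f x (B y);
  md_fndg : forall x, g x -> (forall y, g y -> f x y = 0) -> x = 0;
  md_fnda : forall x, a x -> (forall y, a y -> f x y = 0) -> x = 0;
  md_t0 : t != 0
}.

(** What is used of the adjoint action of an element of the subgroup: it preserves
    [f] and the form x, y |-> f x (B y). *)
Record metric_auto (R : realType) (N : nat) (g a : set 'M[R]_N)
    (f : 'M[R]_N -> 'M[R]_N -> R) (B T : {linear 'M[R]_N -> 'M[R]_N}) : Prop :=
  MetricAuto {
  ma_Tg : forall x, g x -> g (T x);
  ma_Ta : forall x, a x -> a (T x);
  ma_Tsurj : forall y, a y -> exists2 x, a x & y = T x;
  ma_Tf : forall x y, g x -> g y -> f (T x) (T y) = f x y;
  ma_TfB : forall x y, a x -> a y -> f (T x) (B (T y)) = f x (B y)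
}.

Section algebra.
Variables (R : realType) (N : nat).
Let E := 'M[R]_N.
Variables (g a : set E) (f : E -> E -> R).
Variables (P B S : {linear E -> E}) (t : R).
Hypothesis D : metric_data g a f P B S t.
Let fC := md_fC D.
Let fP := md_fP D.
Let gP := md_gP D.
Let ag := md_ag D.
Let Pa := md_Pa D.
Let Pid := md_Pid D.
Let fPz := md_fPz D.
Let Ba := md_Ba D.
Let Sa := md_Sa D.
Let BS := md_BS D.
Let SB := md_SB D.
Let Bsym := md_Bsym D.
Let fndg := md_fndg D.
Let fnda := md_fnda D.
Let t0 := md_t0 D.

Lemma form_addl x y z : f (x + y) z = f x z + f y z.
Proof. by rewrite -[x in LHS]scale1r fP mul1r. Qed.
Lemma form_0l z : f 0 z = 0.
Proof. by apply/(addrI (f 0 z)); rewrite -form_addl !addr0. Qed.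
Lemma form_scalel k x z : f (k *: x) z = k * f x z.
Proof. by rewrite -[k *: x]addr0 fP form_0l addr0. Qed.
Lemma form_oppl x z : f (- x) z = - f x z.
Proof. by rewrite -scaleN1r form_scalel mulN1r. Qed.
Lemma form_addr x y z : f z (x + y) = f z x + f z y.
Proof. by rewrite fC form_addl !(fC z). Qed.
Lemma form_scaler k x z : f z (k *: x) = k * f z x.
Proof. by rewrite fC form_scalel fC. Qed.
Lemma form_oppr x z : f z (- x) = - f z x.
Proof. by rewrite fC form_oppl fC. Qed.
Definition form_simpl :=
  (form_addl, form_addr, form_scalel, form_scaler, form_oppl, form_oppr).

Definition linop_simpl :=
  (linop_add P, linop_opp P, linop_scale P,
   linop_add B, linop_opp B, linop_scale B,
   linop_add S, linop_opp S, linop_scale S).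

Lemma sub_of_projK x : P x = x -> a x. Proof. by move=> <-; exact: Pa. Qed.
Lemma sub_lin k x y : a x -> a y -> a (k *: x + y).
Proof. by move=> ax ay; apply: sub_of_projK; rewrite linearP !Pid. Qed.
Lemma sub_add x y : a x -> a y -> a (x + y).
Proof. by move=> ax ay; apply: sub_of_projK; rewrite linearD !Pid. Qed.
Lemma sub_opp x : a x -> a (- x).
Proof. by move=> ax; apply: sub_of_projK; rewrite linearN !Pid. Qed.
Lemma sub_scale k x : a x -> a (k *: x).
Proof. by move=> ax; apply: sub_of_projK; rewrite linearZ/= !Pid. Qed.
Lemma amb_proj x : g (P x). Proof. exact: ag. Qed.
Lemma amb_add x y : g x -> g y -> g (x + y).
Proof. by move=> gx gy; rewrite -[x]scale1r; exact: gP. Qed.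
Lemma amb_0 : g 0. Proof. by rewrite -(linear0 P); exact: amb_proj. Qed.
Lemma amb_scale k x : g x -> g (k *: x).
Proof. by move=> gx; rewrite -[_ *: _]addr0; apply: gP => //; exact: amb_0. Qed.
Lemma amb_opp x : g x -> g (- x).
Proof. by move=> gx; rewrite -scaleN1r; exact: amb_scale. Qed.
Lemma amb_sub x y : g x -> g y -> g (x - y).
Proof. by move=> gx gy; apply: amb_add => //; exact: amb_opp. Qed.

Hint Resolve Pa Ba Sa amb_proj sub_add sub_opp sub_scale : core.

Lemma form_projr x z : a x -> f x z = f x (P z).
Proof. by move=> ax; rewrite fC fPz// fC. Qed.
Lemma proj_idem x : P (P x) = P x. Proof. exact: Pid. Qed.
Lemma proj_B x : P (B x) = B x. Proof. exact: Pid. Qed.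
Lemma proj_S x : P (S x) = S x. Proof. exact: Pid. Qed.
Lemma S_sym x y : a x -> a y -> f (S x) y = f x (S y).
Proof. by move=> ax ay; rewrite -{2}(BS ax) Bsym// BS. Qed.

(** Operators on [a] are compared through the nondegenerate form, which is where
    their commutation rules come from. *)
Lemma form_separates x y : a x -> a y -> (forall z, a z -> f x z = f y z) -> x = y.
Proof.
move=> ax ay xy; apply/eqP; rewrite -subr_eq0; apply/eqP; apply: fnda; first by auto.
by move=> z az; rewrite form_addl form_oppl xy// subrr.
Qed.

Definition beta_form X Y := t * f X Y - f (B (P X) + t *: P X) (P Y).

Lemma beta_formC X Y : beta_form X Y = beta_form Y X.
Proof.
rewrite /beta_form fC !form_simpl Bsym//; congr (_ - (_ + _)); first by rewrite fC.
by rewrite [f (P X) _]fC.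
Qed.

Lemma beta_formP k X Y Z :
  beta_form (k *: X + Y) Z = k * beta_form X Z + beta_form Y Z.
Proof. by rewrite /beta_form !linearP !form_simpl; ring. Qed.

(** Testing against [a] gives B P X = 0, hence P X = 0; the form then reduces to
    the multiple t f of the nondegenerate one. *)
Lemma beta_form_nd X : g X -> (forall Y, g Y -> beta_form X Y = 0) -> X = 0.
Proof.
move=> gX X0; have PX0 : P X = 0.
  have BPX0 : B (P X) = 0.
    apply: fnda => // Y aY; have := X0 Y (ag aY).
    rewrite /beta_form (Pid aY) form_simpl fPz// form_scalel => /eqP.
    by rewrite opprD addrCA subrr addr0 oppr_eq0 => /eqP.
  by rewrite -(SB (Pa X)) BPX0 linear0.
apply: fndg => // Y gY; have := X0 Y gY.
rewrite /beta_form PX0 linear0 scaler0 addr0 form_0l subr0 => /eqP.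
by rewrite mulf_eq0 (negbTE t0) => /eqP.
Qed.

(** (B + t) B^-1, the operator Bhat of the statement. *)
Definition hatB x := x + t *: S x.

Lemma sub_hatB x : a x -> a (hatB x). Proof. by rewrite /hatB; auto. Qed.

(** The form on m of the statement, simplified by the identity
    t^2 B^-1 (I + t^-1 B) = t^2 B^-1 + t on [a]. *)
Definition m_form X Y := t * f X Y - f (t ^+ 2 *: S (P X) + t *: P X) (P Y).

(** The form on m is the form on [g] transported by X |-> X - Bhat P X, which is
    the map (X, Y) |-> X - Y on m.  Nondegeneracy and invariance follow. *)
Lemma m_formE X Y :
  m_form X Y = beta_form (X - hatB (P X)) (Y - hatB (P Y)).
Proof.
rewrite /m_form /beta_form /hatB.
rewrite ?linop_simpl !proj_idem !proj_S ?linop_simpl !BS// ?form_simpl.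
rewrite (fPz X (Pa Y)) (fPz X (Sa _)) (form_projr Y (Pa X)) (form_projr Y (Sa _)).
by rewrite -!S_sym//; ring.
Qed.

(** Since Bhat - 1 = t B^-1 on [a], X - Bhat P X has orthogonal part X - P X and
    [a]-part - t B^-1 P X; solve for X. *)
Lemma sub_hatB_surj Y : g Y -> exists2 X, g X & Y = X - hatB (P X).
Proof.
move=> gY; exists (Y - P Y - t^-1 *: B (P Y)).
  by apply: amb_sub; [apply: amb_sub|apply: ag; auto].
by rewrite /hatB ?linop_simpl proj_idem proj_B subrr sub0r ?linop_simpl SB//; mxfield.
Qed.

(** The trivial intersection of m and the diagonal: Bhat - 1 = t B^-1 is
    injective. *)
Lemma hatB_fixed_eq0 X : X = hatB (P X) -> X = 0.
Proof.
move=> XE; have aX : a X by rewrite XE; apply: sub_hatB.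
have S0 : S X = 0.
  move: XE; rewrite Pid// /hatB -{1}[X]addr0 => /addrI/esym/eqP.
  by rewrite scaler_eq0 (negbTE t0) => /eqP.
by rewrite -(BS aX) S0 linear0.
Qed.

(** The operator I + beta0^-1 B of the statement. *)
Definition opIB x := x + t^-1 *: B x.

Lemma opIB_decomposition X Y : a Y ->
  hatB (P (X - opIB (P X) + t^-1 *: B Y)) = - opIB (P (X - Y)) /\
  (X, Y) = (X - opIB (P X) + t^-1 *: B Y, - opIB (P (X - Y))) +
           (Y + opIB (P (X - Y)), Y + opIB (P (X - Y))).
Proof.
move=> aY; split.
  have -> : P (X - opIB (P X) + t^-1 *: B Y) = - (t^-1 *: B (P (X - Y))).
    by rewrite /opIB ?linop_simpl proj_idem !proj_B (Pid aY) ?linop_simpl; mxfield.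
  by rewrite /hatB /opIB ?linop_simpl !SB// ?linop_simpl; mxfield.
rewrite /opIB ?linop_simpl (Pid aY); congr (_, _) => /=; first by mxfield.
by rewrite addrCA addNr addr0.
Qed.

Section bracket.
Let br (x y : E) := x *m y - y *m x.
Hypothesis gbr : forall x y, g x -> g y -> g (br x y).
Hypothesis abr : forall x y, a x -> a y -> a (br x y).
Hypothesis fbr : forall x y z, g x -> g y -> g z -> f (br x y) z = f (br z x) y.
Hypothesis Bbr : forall x y z, a x -> a y -> a z ->
  f (br x y) (B z) = f (br z x) (B y).

(** Both forms f and f(., B .) are invariant, so B commutes with ad on [a]. *)
Lemma bracket_B x y : a x -> a y -> B (br x y) = br x (B y).
Proof.
move=> ax ay; apply: form_separates; [by []|exact: abr|move=> z az].
rewrite Bsym//; last exact: abr.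
by rewrite Bbr// -fbr//; apply: ag.
Qed.

Lemma bracket_opp x y : br x y = - br y x.
Proof. by rewrite /br opprB. Qed.

Lemma bracket_addr x y z : br x (y + z) = br x y + br x z.
Proof. by rewrite /br mulmxDl mulmxDr; mxfield. Qed.

Lemma bracket_scaler k x y : br x (k *: y) = k *: br x y.
Proof. by rewrite /br -scalemxAl -scalemxAr scalerBr. Qed.

Lemma bracket_S x y : a x -> a y -> S (br x y) = br x (S y).
Proof.
by move=> ax ay; rewrite -{1}(BS ay) -bracket_B// SB//; exact: abr.
Qed.

Lemma bracket_hatB x y : a x -> a y -> hatB (br x y) = br x (hatB y).
Proof. by move=> ax ay; rewrite /hatB bracket_addr bracket_scaler bracket_S. Qed.

Lemma hatB_sym x y : a x -> a y -> f (hatB x) y = f x (hatB y).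
Proof. by move=> ax ay; rewrite /hatB !form_simpl S_sym. Qed.

Lemma hatB_opp x : hatB (- x) = - hatB x.
Proof. by rewrite /hatB ?linop_simpl; mxfield. Qed.

(** Write D for Bhat; it is self-adjoint and commutes with ad on [a].  Then
    <x, [Dy, Dz]> = <[x, Dy], Dz> = <[x, D D y], z> = <[z, x], D D y>
    = <D D [z, x], y> = <[Dz, Dx], y>. *)
Lemma cubic_cyclic x y z : a x -> a y -> a z ->
  f x (br (hatB y) (hatB z)) = f y (br (hatB z) (hatB x)).
Proof.
move=> ax ay az; have dx := sub_hatB ax; have dy := sub_hatB ay; have dz := sub_hatB az.
have azx := abr az ax.
rewrite fC fbr; [|exact: ag..].
rewrite -hatB_sym//; last exact: abr.
rewrite bracket_hatB// fbr; [|exact: ag|exact/ag/sub_hatB|exact: ag].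
rewrite -!hatB_sym//; last exact: sub_hatB.
by rewrite (bracket_hatB az ax) bracket_opp hatB_opp bracket_hatB// -bracket_opp fC.
Qed.

(** The first component of the m-part of the bracket of (X, Bhat P X) and
    (Y, Bhat P Y), read off from [opIB_decomposition]. *)
Definition m_proj1 X Y :=
  br X Y - opIB (P (br X Y)) + t^-1 *: B (br (hatB (P X)) (hatB (P Y))).

(** Write W for [X, Y] and Q for [Bhat P X, Bhat P Y].  The m-part of the bracket
    is W - (I + t^-1 B) P W + t^-1 B Q; moving B across the symmetric form cancels
    it against S = B^-1, so that all terms in P W cancel and of those in Q only
    - t <P Z, Q> is left. *)
Lemma m_form_bracket X Y Z : g X -> g Y -> g Z ->
  m_form Z (m_proj1 X Y) = t * (f Z (br X Y) - f (P Z) (br (hatB (P X)) (hatB (P Y)))).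
Proof.
move=> gX gY gZ; rewrite /m_form /m_proj1 /opIB.
have := abr (sub_hatB (Pa X)) (sub_hatB (Pa Y)); have := gbr gX gY.
move: (br X Y) (br (hatB _) (hatB _)) => W Q gW aQ.
rewrite ?linop_simpl !proj_idem !proj_B ?form_simpl.
rewrite (fPz Z (Pa _)) (fPz Z (Ba _)).
rewrite -(Bsym (Sa (P Z)) (Pa W)) -(Bsym (Sa (P Z)) aQ) !BS// (fPz Z (Ba Q)).
by field.
Qed.

Lemma nr_cyclic X Y Z : g X -> g Y -> g Z ->
  m_form X (m_proj1 Y Z) = m_form Y (m_proj1 Z X).
Proof.
move=> gX gY gZ; rewrite !m_form_bracket// cubic_cyclic//.
by rewrite ![f _ (br _ _)]fC fbr// [f (br X Y) _]fbr.
Qed.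

End bracket.

Section invariance.
Variable T : {linear E -> E}.
Hypothesis DT : metric_auto g a f B T.
Let Tg := ma_Tg DT.
Let Ta := ma_Ta DT.
Let Tsurj := ma_Tsurj DT.
Let Tf := ma_Tf DT.
Let TfB := ma_TfB DT.

(** Intertwining operators commute with isometries of [a]. *)
Lemma auto_B x : a x -> B (T x) = T (B x).
Proof.
move=> ax; apply: form_separates => [//||_ /Tsurj[z az ->]]; first exact: Ta.
by rewrite fC TfB// Tf; [exact: fC|exact: ag..].
Qed.

Lemma auto_S x : a x -> S (T x) = T (S x).
Proof.
by move=> ax; rewrite -{1}(BS ax) -auto_B// SB//; exact: Ta.
Qed.

(** An isometry of [g] that preserves [a] preserves its orthogonal. *)
Lemma auto_proj x : g x -> P (T x) = T (P x).
Proof.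
move=> gx; apply: form_separates => [//||_ /Tsurj[z az ->]]; first exact: Ta.
have gz := ag az; rewrite -fPz; last exact: Ta.
by rewrite !Tf// fPz.
Qed.

Lemma auto_hatB x : a x -> hatB (T x) = T (hatB x).
Proof. by move=> ax; rewrite /hatB auto_S// linearD linearZ. Qed.

Lemma beta_form_inv X Y : g X -> g Y ->
  beta_form (T X) (T Y) = beta_form X Y.
Proof.
move=> gX gY; rewrite /beta_form Tf// !auto_proj// auto_B// -linearZ -linearD Tf//.
by apply: amb_add; apply: ag; auto.
Qed.

End invariance.

Section bi_invariant_metric.
Variable Q : {linear E -> E}.
Let Bp x := B x + t *: x.
Hypothesis Qa : forall x, a (Q x).
Hypothesis BQ : forall x, a x -> Bp (Q x) = x.
Hypothesis QB : forall x, a x -> Q (Bp x) = x.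
Hint Resolve Qa : core.

Lemma Q_sym x y : a x -> a y -> f (Q x) y = f x (Q y).
Proof.
move=> ax ay; rewrite -{1}(BQ ay) -{2}(BQ ax) /Bp ?form_simpl Bsym//.
Qed.

Lemma Q_comm_B x : a x -> Q (B x) = B (Q x).
Proof.
move=> ax; rewrite -{1}(BQ ax) /Bp ?linop_simpl -[RHS]QB// /Bp.
Qed.

Lemma BQ_sym x y : a x -> a y -> f (B (Q x)) y = f x (B (Q y)).
Proof. by move=> ax ay; rewrite Bsym// Q_sym// Q_comm_B. Qed.

Lemma BQ_eq0 x : a x -> B (Q x) = 0 -> x = 0.
Proof.
move=> ax B0; have Q0 : Q x = 0 by rewrite -(SB (Qa x)) B0 linear0.
by rewrite -(BQ ax) /Bp Q0 linear0 scaler0 addr0.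
Qed.

Lemma Q_hatB x : a x -> Q (hatB x) = S x.
Proof. by move=> ax; rewrite -[RHS]QB// /Bp BS. Qed.

(** Q is the inverse of B + t on [a], so B Q Bhat = B S = 1 there. *)
Lemma product_form_on_m X Y : t * f X Y - f (t *: B (Q (hatB (P X)))) (hatB (P Y)) = m_form X Y.
Proof.
rewrite /m_form Q_hatB// BS// /hatB ?form_simpl -S_sym//; ring.
Qed.

(** Orthogonality to the diagonal means P X = B Q A; applying (B + t) B^-1 gives
    A = Bhat P X. *)
Lemma horizontal_in_m X A : a A ->
  (forall H, a H -> t * f X H - f (t *: B (Q A)) H = 0) -> A = hatB (P X).
Proof.
move=> aA H0; have PE : P X = B (Q A).
  apply: form_separates => // z az; have := H0 z az.
  rewrite fPz// form_scalel -mulrBr => /eqP; rewrite mulf_eq0 (negbTE t0)/= subr_eq0.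
  by move/eqP.
by rewrite PE /hatB SB// -{1}(BQ aA).
Qed.

(** A vector of the diagonal orthogonal to the diagonal lies in m as well. *)
Lemma vertical_nondegenerate x : a x ->
  (forall y, a y -> t * f x y - f (t *: B (Q x)) y = 0) -> x = 0.
Proof.
move=> ax H0; have := horizontal_in_m ax H0; rewrite Pid// => xE.
by apply: hatB_fixed_eq0; rewrite Pid.
Qed.

Lemma auto_Q (T : {linear E -> E}) x : (forall x, a x -> a (T x)) ->
  (forall x, a x -> B (T x) = T (B x)) -> a x -> Q (T x) = T (Q x).
Proof.
move=> Ta TB ax; rewrite -{1}(BQ ax) -[RHS]QB; last exact: Ta.
by rewrite /Bp TB// linearD linearZ.
Qed.

End bi_invariant_metric.

End algebra.

(** * Global extension of the form and of the operators *)

Section extension.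
Variables (R : realType) (N : nat).
Let E := 'M[R]_N.

Lemma linear_row_eq0 (W : lmodType R) d (psi : {linear 'rV[R]_d -> W}) :
  (forall j, psi (delta_mx 0 j) = 0) -> forall w, psi w = 0.
Proof.
move=> psi0 w; rewrite (row_sum_delta w) linear_sum big1// => j _.
by rewrite linearZ/= psi0 scaler0.
Qed.

Definition linear_on (V : set E) (h : E -> E) :=
  forall (k : R) x y, V x -> V y -> h (k *: x + y) = k *: h x + h y.

Definition is_subspace (V : set E) := forall (k : R) x y, V x -> V y -> V (k *: x + y).

Lemma inv_on_spec (V : set E) (h : E -> E) : set_bij V V h ->
  [/\ forall x, V x -> V (inv_on V h x),
      forall x, V x -> h (inv_on V h x) = x &
      forall x, V x -> inv_on V h (h x) = x].
Proof.
move=> bV; have [hV hi hs] := bV; split=> x Vx.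
- by have [iV _ _] : set_bij V V (inv_on V h) := bijpinv_bij _ bV; exact: iV.
- by apply: (surjpK (fun=> 0) hs); rewrite inE.
- by apply: (pinvKV _ hi); rewrite inE.
Qed.

Lemma inv_on_linear (V : set E) (h : E -> E) : is_subspace V -> set_bij V V h ->
  linear_on V h -> linear_on V (inv_on V h).
Proof.
move=> sV bV lh; have [iV hi ih] := inv_on_spec bV.
have [_ inj _] := bV => k x y Vx Vy.
have [Vix Viy] := (iV _ Vx, iV _ Vy).
apply: inj; rewrite ?inE; [exact/iV/sV|exact: sV|].
by rewrite lh// !hi//; exact: sV.
Qed.

Lemma linear_on_extend (V : set E) (pr : {linear E -> E}) (h : E -> E) :
  (forall x, V (pr x)) -> (forall x, V x -> pr x = x) -> linear_on V h ->
  exists H : {linear E -> E}, (forall x, H x = h (pr x)) /\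
    (forall x, V x -> h x = H x).
Proof.
move=> Vpr prid lh.
have lH : linear (fun x => h (pr x)) by move=> k x y; rewrite linearP lh.
pose H : {linear E -> E} :=
  HB.pack (fun x => h (pr x)) (GRing.isLinear.Build _ _ _ _ _ lH).
by exists H; split=> // x Vx; rewrite /= prid.
Qed.

Lemma range_subspace d (L : {linear 'rV[R]_d -> E}) : is_subspace (range L).
Proof. by move=> k _ _ [u _ <-] [v _ <-]; exists (k *: u + v); rewrite ?linearP. Qed.

(** The Gram matrix of the form in a basis of the subspace is invertible, and
    solves for the coordinates of the projection. *)
Lemma gram_projection d (M : {linear 'rV[R]_d -> E}) (f : E -> E -> R) :
  injective M -> (forall x y, f x y = f y x) ->
  (forall k x y z, f (k *: x + y) z = k * f x z + f y z) ->
  (forall x, range M x -> (forall y, range M y -> f x y = 0) -> x = 0) ->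
  forall X, exists2 Y, range M Y & forall z, range M z -> f X z = f Y z.
Proof.
move=> iM fC fP nd X.
have l1 y : linear (fun w => f (M w) y : R).
  by move=> k u v; rewrite linearP fP.
have l2 x : linear (fun w => f x (M w) : R).
  by move=> k u v; rewrite linearP fC fP !(fC _ x).
have l2' k x u v : f x (M (k *: u + v)) = k * f x (M u) + f x (M v).
  by rewrite linearP fC fP !(fC _ x).
pose psi x : {linear 'rV[R]_d -> R} :=
  HB.pack (fun w => f x (M w) : R) (GRing.isLinear.Build _ _ _ _ _ (l2 x)).
(* phi lists the products with the basis; lin1_mx Phi is the Gram matrix. *)
pose phi v : 'rV[R]_d := \row_j f v (M (delta_mx 0 j)).
have lphi : linear (fun w => phi (M w)).
  by move=> k u v; apply/rowP => j; rewrite !mxE l1.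
pose Phi : {linear 'rV[R]_d -> 'rV[R]_d} :=
  HB.pack (fun w => phi (M w)) (GRing.isLinear.Build _ _ _ _ _ lphi).
have phiE x y : phi x = phi y -> forall z, range M z -> f x z = f y z.
  move=> xy _ [w _ <-]; apply/eqP; rewrite -subr_eq0; apply/eqP.
  have ld : linear (fun w => psi x w - psi y w).
    by move=> k u v /=; rewrite !l2' -[_ *: _]/(_ * _); ring.
  pose dl : {linear 'rV[R]_d -> R} :=
    HB.pack (fun w => psi x w - psi y w) (GRing.isLinear.Build _ _ _ _ _ ld).
  apply: (linear_row_eq0 (psi := dl)) => j /=.
  by move/rowP : xy => /(_ j); rewrite !mxE => ->; rewrite subrr.
have uQ : lin1_mx Phi \in unitmx.
  rewrite -row_free_unit; apply: inj_row_free => v; rewrite mul_rV_lin1 /= => v0.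
  apply: iM; rewrite linear0; apply: nd; first by exists v.
  have phi0 : phi (M v) = phi 0.
    by rewrite v0; have := linear0 Phi; rewrite /= linear0.
  move=> y My; rewrite (phiE _ _ phi0)//.
  by apply: (addrI (f 0 y)); rewrite addr0 -{1}[f 0 y]mul1r -fP scaler0 addr0.
exists (M (phi X *m invmx (lin1_mx Phi))); first by eexists.
apply: phiE; rewrite -[RHS]/(Phi _) -mul_rV_lin1.
by rewrite mulmxKV.
Qed.

(** The form is precomposed with a projection onto [g], the operators with a
    projection onto [a]; the orthogonal projection is well defined, hence linear,
    by [gram_projection] and nondegeneracy on [a]. *)
Lemma metric_data_exists d e (L : {linear 'rV[R]_d -> E}) (M : {linear 'rV[R]_e -> E})
    (form : E -> E -> R) (B0 : E -> E) (t : R) :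
  let g := range L in let a := range M in
  injective M -> a `<=` g -> sym_form g form -> nondegenerate_on g form ->
  nondegenerate_on a form -> set_bij a a B0 -> linear_on a B0 ->
  (forall x y, a x -> a y -> form (B0 x) y = form x (B0 y)) -> t != 0 ->
  exists f (P B S : {linear E -> E}), metric_data g a f P B S t /\
    [/\ forall x y, g x -> g y -> form x y = f x y,
        forall x, g x -> orth_proj form a x = P x,
        forall x, a x -> B0 x = B x &
        forall x, a x -> inv_on a B0 x = S x].
Proof.
move=> g a iM ag [formC formP] ndg nda bB lB Bsym t0.
have [prg [gprg prgid]] := range_projection L.
have [pra [apra praid]] := range_projection M.
rewrite -/g -/a in gprg prgid apra praid.
have sa : is_subspace a by exact: range_subspace.
have [B [BE BE']] := linear_on_extend apra praid lB.
have [S [SE SE']] := linear_on_extend apra praid (inv_on_linear sa bB lB).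
have [iV hi ih] := inv_on_spec bB.
have [B0a _ _] := bB.
pose f x y := form (prg x) (prg y).
have fE x y : g x -> g y -> form x y = f x y by move=> gx gy; rewrite /f !prgid.
have fC x y : f x y = f y x by rewrite /f formC.
have fP k x y z : f (k *: x + y) z = k * f x z + f y z.
  by rewrite /f linearP formP.
have nda' x : a x -> (forall y, a y -> f x y = 0) -> x = 0.
  by move=> ax x0; apply: nda => // y ay; rewrite fE ?x0//; exact: ag.
have exP := gram_projection iM fC fP nda'.
have fB x y z : f (x - y) z = f x z - f y z.
  by rewrite -scaleN1r addrC fP mulN1r addrC.
have uniqP x y y' : a y -> a y' -> (forall z, a z -> f x z = f y z) ->
    (forall z, a z -> f x z = f y' z) -> y = y'.
  move=> ay ay' xy xy'; apply/eqP; rewrite -subr_eq0; apply/eqP; apply: nda'.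
    by rewrite -scaleN1r addrC; exact: sa.
  by move=> z az; rewrite fB -xy// -xy'// subrr.
pose P0 x := orth_proj form a (prg x).
have P0P x : a (P0 x) /\ forall z, a z -> f x z = f (P0 x) z.
  have [Y aY YE] := exP x.
  have : [set y | a y /\ forall z, a z -> form (prg x - y) z = 0] (P0 x).
    apply: xgetPex; exists Y; split=> // z az; have gz := ag _ az.
    have -> : prg x - Y = prg (x - Y) by rewrite linearB/= [prg Y]prgid//; exact: ag.
    by rewrite -[z]prgid// -[form _ _]/(f _ _) fB YE// subrr.
  move=> [aP PE]; split=> // z az; have gz := ag _ az; have := PE z az.
  have -> : prg x - P0 x = prg (x - P0 x) by rewrite linearB/= [prg (P0 x)]prgid//; exact: ag.
  by rewrite -[z in form _ z]prgid// -[form _ _]/(f _ _) fB => /eqP; rewrite subr_eq0 => /eqP.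
have lP : linear P0.
  move=> k x y; have [ax xE] := P0P x; have [ay yE] := P0P y.
  have [axy xyE] := P0P (k *: x + y).
  apply: (uniqP (k *: x + y)) => //; first exact: sa.
  by move=> z az; rewrite !fP xE// yE.
pose P : {linear E -> E} := HB.pack P0 (GRing.isLinear.Build _ _ _ _ _ lP).
exists f, P, B, S; split; last first.
  by split=> // x gx; rewrite /= /P0 prgid.
split=> //.
- exact: range_subspace.
- by move=> x; have [] := P0P x.
- move=> x ax; have [aPx PxE] := P0P x; exact: (uniqP x).
- by move=> x z az; have [_] := P0P x; exact.
- by move=> x; rewrite BE; exact/B0a/apra.
- by move=> x; rewrite SE; exact/iV/apra.
- by move=> x ax; rewrite -SE'// -BE' ?hi//; exact: iV.
- by move=> x ax; rewrite -BE'// -SE' ?ih//; exact: B0a.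
- by move=> x y ax ay; rewrite -!BE'// -!fE ?Bsym//; apply: ag => //; exact: B0a.
- by move=> x gx x0; apply: ndg => // y gy; rewrite fE ?x0.
Qed.

End extension.

(** * The two-sided action *)

Section two_sided_action.
Variables (R : realType) (N : nat) (G A : submfd 'M[R]_N).
Let E := 'M[R]_N.
Let o := GL_ops R N.
Let ot := prod_ops o o.
Let Gt := prod_submfd G A.
Let Ht := diag_submfd A.
Let g := lie_algebra o G.
Let a := lie_algebra o A.
Hypothesis mG : matrix_lie_group G.
Hypothesis sA : lie_subgroup o A G.

Let LG : lie_group o G. Proof. by case: mG. Qed.
Let LA : lie_group o A. Proof. by case: sA. Qed.
Let imG : immersed G. Proof. by case: LG. Qed.
Let imA : immersed A. Proof. by case: LA. Qed.
Let iG := immersed_inj imG.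
Let iA := immersed_inj imA.

Lemma subgroup_pts k : pts A k -> pts G k.
Proof. by case: sA => _ + _; exact. Qed.

Lemma subgroup_mlg : matrix_lie_group A.
Proof. by split=> // k /subgroup_pts; case: mG => _; exact. Qed.
Let mA := subgroup_mlg.

Lemma subgroup_lie_algebra : a `<=` g.
Proof.
move=> v av; have [_ _ AG] := sA.
have D := is_diff_idf (1%:M : E).
have := tangent_map imA imG AG (@ex_diff _ _ _ _ _ _ _ D) av.
by rewrite (is_diffE _ D).
Qed.

Lemma prod_lie_algebra : lie_algebra ot Gt = g `*` a.
Proof. exact: tangent_prod. Qed.

Lemma diag_lie_algebra : lie_algebra ot Ht = [set z | a z.1 /\ z.2 = z.1].
Proof. exact: tangent_diag. Qed.

(** Tangent vectors are left translates of the Lie algebra, in the form in which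
    they appear in [induces] and [pr_submersion]. *)
Lemma prod_tangentP p v : pts Gt p ->
  tangent Gt p v <-> exists2 x, (g `*` a) x & v = gmul ot p x.
Proof.
case: p v => p1 p2 [v1 v2] [/= Gp Ap]; rewrite tangent_prod//.
have u1 := mlg_unit mG Gp; have u2 := mlg_unit mA Ap; split.
  move=> [/= /(tangentE mG _ Gp) h1 /(tangentE mA _ Ap) h2].
  by exists (invmx p1 *m v1, invmx p2 *m v2); rewrite //= !mulKVmx.
move=> [[x1 x2] [/= gx ax] [-> ->]]; split=> /=.
  by apply/(tangentE mG _ Gp); rewrite mulKmx.
by apply/(tangentE mA _ Ap); rewrite mulKmx.
Qed.

Lemma gmulK p x : pts Gt p -> gmul ot (ginv ot p) (gmul ot p x) = x.
Proof.
case: p x => p1 p2 [x1 x2] [/= Gp Ap].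
by rewrite !mulKmx//; [exact: mlg_unit mA _ Ap|exact: mlg_unit mG _ Gp].
Qed.

Lemma smooth_mulmx (F : normedModType R) (M : submfd F) (u v : F -> E) :
  immersed M -> smooth_map M G u -> smooth_map M G v ->
  smooth_map M G (fun x => u x *m v x).
Proof.
move=> imM su sv; have [_ _ _ sm _] := LG.
have imGG := immersed_prod imG imG.
exact: (smooth_map_comp imM imGG iG (smooth_map_pair iG iG su sv) sm).
Qed.

Lemma smooth_snd_inv (F : normedModType R) (M : submfd F) (u : F -> E * E) :
  immersed M -> smooth_map M Gt u -> smooth_map M G (fun x => invmx (u x).2).
Proof.
move=> imM su; have [_ _ AG] := sA; have [_ _ _ _ sv] := LG.
have imGt : immersed Gt by exact: immersed_prod.
have s2 := smooth_map_comp imM imGt iA su (smooth_map_snd imG imA).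
have s2' := smooth_map_comp imM imA iG s2 AG.
exact: (smooth_map_comp imM imG iG s2' sv).
Qed.

Lemma smooth_two_sided :
  smooth_map (prod_submfd Gt G) G (fun z => two_sided z.1 z.2).
Proof.
have imGt : immersed Gt by exact: immersed_prod.
have imP := immersed_prod imGt imG.
have s1 := smooth_map_fst imGt imG; have s2 := smooth_map_snd imGt imG.
have s11 := smooth_map_comp imP imGt iG s1 (smooth_map_fst imG imA).
apply: smooth_mulmx => //; first exact: smooth_mulmx.
exact: smooth_snd_inv.
Qed.

Lemma smooth_qmap : smooth_map Gt G (@qmap R N).
Proof.
have imGt : immersed Gt by exact: immersed_prod.
have [_ _ sid] := imGt.
apply: smooth_mulmx => //; first exact: smooth_map_fst.
exact: (smooth_snd_inv imGt sid).
Qed.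

(** The action is transitive already through the first factor, and X A^-1 = 1
    forces X = A. *)
Lemma two_sided_homogeneous : homogeneous ot Gt Ht G (@two_sided R N) 1%:M.
Proof.
have G1 := mlg1 mG; have A1 := mlg1 mA.
split.
- by split; [exact: lie_group_prod|exact: lie_subgroup_diag].
- exact: smooth_two_sided.
- split=> [y Gy|p q y [/= Gp Ap] [/= Gq Aq] Gy]; rewrite /two_sided /=.
    by rewrite invmx1 mul1mx mulmx1.
  have u1 := mlg_unit mA Ap; have u2 := mlg_unit mA Aq.
  have -> : invmx (p.2 *m q.2) = invmx q.2 *m invmx p.2.
    have u12 : p.2 *m q.2 \in unitmx by rewrite unitmx_mul u1 u2.
    apply: (can_inj (mulKmx u12)); rewrite mulmxV//.
    by rewrite mulmxA mulmxK// mulmxV.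
  by rewrite !mulmxA.
- split=> // y Gy; exists (y, 1%:M); first by split.
  by rewrite /two_sided/= mulmx1 invmx1 mulmx1.
- apply/seteqP; split=> -[p1 p2] /=; rewrite /two_sided/= mulmx1.
    move=> [[/= Gp Ap] e]; have u2 := mlg_unit mA Ap.
    have -> : p1 = p2 by rewrite -[p1](mulmxKV u2) e mul1mx.
    by [].
  move=> [/= Ap ->]; split; first by split=> //=; exact: subgroup_pts.
  by rewrite (mulmxV (mlg_unit mA Ap)).
Qed.

(** The differential of the orbit map of 1 on the left translate of [v] by [p]. *)
Definition dorb (p v : E * E) : E := p.1 *m (v.1 - v.2) *m invmx p.2.

Lemma is_diff_orb (p : 'M[R]_N * 'M[R]_N) : p.2 \in unitmx ->
  exists2 d : E * E -> E, is_diff p (fun q => two_sided q 1%:M) d &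
    forall v, d (gmul ot p v) = dorb p v.
Proof.
move=> u2; eexists.
  exact: (is_diff_mulmx (is_diff_mulmx (is_diff_fst p) (is_diff_const 1%:M p))
    (is_diff_invmx u2 (is_diff_snd p))).
move=> v /=; rewrite mulmx0 add0r !mulmx1 mulKmx// /dorb.
by rewrite mulmxBr mulmxBl mulmxN !mulmxA addrC.
Qed.

Lemma qmapE : @qmap R N = fun q => two_sided q 1%:M.
Proof. by apply/funext => q; rewrite /qmap /two_sided mulmx1. Qed.

Lemma dorb_closed p x : pts Gt p -> (g `*` a) x ->
  tangent G (two_sided p 1%:M) (dorb p x).
Proof.
move=> [Gp Ap] [gx ax]; rewrite /two_sided mulmx1.
apply: (tangent_mulr mG); first exact/subgroup_pts/(mlgV mA).
have := tangent_mull mG Gp; move=> /(_ 1%:M (x.1 - x.2)); rewrite mulmx1; apply.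
have [d [L [_ gE]]] := tangent_param_mlg mG (mlg1 mG).
rewrite gE -scaleN1r addrC; apply: range_subspace; rewrite -gE//.
exact: subgroup_lie_algebra.
Qed.

(** Translate back on both sides. *)
Lemma dorb_surj p v : pts Gt p -> tangent G (two_sided p 1%:M) v ->
  exists2 Y, g Y & v = p.1 *m Y *m invmx p.2.
Proof.
move=> [Gp Ap]; rewrite /two_sided mulmx1 => tv.
have u1 := mlg_unit mG Gp; have u2 := mlg_unit mA Ap.
exists (invmx p.1 *m v *m p.2); last first.
  by rewrite !mulmxA (mulmxV u1) mul1mx (mulmxK u2).
have := tangent_mulr mG (subgroup_pts Ap) (tangent_mull mG (mlgV mG Gp) tv).
by rewrite mulKmx// mulVmx.
Qed.

End two_sided_action.

(** * The metric on the group *)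

Section naturally_reductive_metric.
Variables (R : realType) (N : nat) (G A : submfd 'M[R]_N).
Let E := 'M[R]_N.
Let o := GL_ops R N.
Let ot := prod_ops o o.
Let Gt := prod_submfd G A.
Let Ht := diag_submfd A.
Let g := lie_algebra o G.
Let a := lie_algebra o A.
Hypothesis mG : matrix_lie_group G.
Hypothesis sA : lie_subgroup o A G.
Variables (form : E -> E -> R) (B0 : E -> E) (t : R).
Hypothesis hform : sym_form g form.
Hypothesis hbi : bi_invariant o G form.
Hypothesis hB : intertwining o A form B0.
Variables (f : E -> E -> R) (P B S : {linear E -> E}).
Hypothesis D : metric_data g a f P B S t.
Hypothesis formE : forall x y, g x -> g y -> form x y = f x y.
Hypothesis projE : forall x, g x -> proj_a A form x = P x.
Hypothesis B0E : forall x, a x -> B0 x = B x.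
Hypothesis B0VE : forall x, a x -> Binv A B0 x = S x.

Let mA : matrix_lie_group A := subgroup_mlg mG sA.
Let ag : a `<=` g := subgroup_lie_algebra mG sA.
Let t0 := md_t0 D.
Let Pa := md_Pa D.
Let Ba := md_Ba D.
Let Sa := md_Sa D.
Let BS := md_BS D.
Let fC := md_fC D.

Let Pg x : g (P x). Proof. exact: ag. Qed.

Let aZ k x : a x -> a (k *: x). Proof. exact: (sub_scale D). Qed.
Let aD x y : a x -> a y -> a (x + y). Proof. exact: (sub_add D). Qed.
Let gB x y : g x -> g y -> g (x - y). Proof. exact: (amb_sub D). Qed.

Lemma BplusE x : a x -> Bplus t B0 x = B x + t *: x.
Proof. by move=> ax; rewrite /Bplus B0E. Qed.

Lemma IBE x : a x -> IB t B0 x = opIB B t x.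
Proof. by move=> ax; rewrite /IB B0E. Qed.

Lemma BhatE x : a x -> Bhat A t B0 x = hatB S t x.
Proof. by move=> ax; rewrite /Bhat B0VE// BplusE// BS. Qed.

Lemma form_betaE x y : g x -> g y ->
  form_beta A form t B0 x y = beta_form f P B t x y.
Proof.
move=> gx gy; rewrite /form_beta /beta_form formE// !projE// BplusE//.
by rewrite formE//; apply: ag; apply: aD => //; exact: aZ.
Qed.

Lemma form_mE z w : g z.1 -> g w.1 ->
  form_m A form t B0 z w = m_form f P S t z.1 w.1.
Proof.
move=> gz gw; rewrite /form_m /m_form formE// !projE// IBE//.
have aC : a (opIB B t (P z.1)) by apply: aD => //; exact: aZ.
rewrite B0VE// formE//; last by apply: ag; exact: aZ.
congr (_ - f _ _); rewrite /opIB linearD linearZ/= (md_SB D)// scalerDr scalerA.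
by rewrite expr2 mulfK.
Qed.

Lemma mtildeP z : mtilde A form t B0 g z <-> g z.1 /\ z.2 = hatB S t (P z.1).
Proof.
by rewrite /mtilde /=; split=> -[gz ->]; split=> //; rewrite projE// BhatE.
Qed.

Let hatB_proj_linear k x y : hatB S t (P (k *: x + y)) = k *: hatB S t (P x) + hatB S t (P y).
Proof. by rewrite /hatB !linearP; mxfield. Qed.

Let AdL (k : E) : {linear E -> E} := mulmxr (invmx k) \o mulmx k.

Let AdLE k x : AdL k x = k *m x *m invmx k. Proof. by []. Qed.

(** Bi-invariance of the two forms, restricted to the subgroup. *)
Lemma Ad_metric_auto k : pts A k -> metric_auto g a f B (AdL k).
Proof.
move=> Ak; have Gk := subgroup_pts sA Ak; have uk := mlg_unit mA Ak.
have Tg x : g x -> g (AdL k x) by exact: (Ad_closed mG Gk).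
have Ta x : a x -> a (AdL k x) by exact: (Ad_closed mA Ak).
have [B0a _ _ Bbi] := hB.
split=> //.
- move=> y ay; exists (AdL (invmx k) y); first exact: (Ad_closed mA (mlgV mA Ak)).
  by rewrite !AdLE invmxK !mulmxA mulmxV// mul1mx mulmxK.
- by move=> x y gx gy; rewrite -!formE//; [exact: hbi|exact: Tg|exact: Tg].
- move=> x y ax ay; rewrite -!B0E//; last exact: Ta.
  rewrite -!formE; last exact/ag/B0a/Ta.
  + exact: Bbi.
  + exact: ag.
  + exact/ag/B0a.
  + exact/ag/Ta.
Qed.

Let hatB0 : hatB S t 0 = 0.
Proof. by rewrite /hatB linear0 scaler0 addr0. Qed.

(** The sum is [opIB_decomposition], the intersection [hatB_fixed_eq0]. *)
Lemma complementary_mh :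
  complementary (g `*` a) (mtilde A form t B0 g) [set z | a z.1 /\ z.2 = z.1].
Proof.
have gX0 : g 0 := amb_0 D.
split.
- split; first by apply/mtildeP; split=> //=; rewrite linear0 hatB0.
  move=> k x y /mtildeP[gx xE] /mtildeP[gy yE]; apply/mtildeP.
  by split=> /=; [exact: (md_gP D)|rewrite xE yE hatB_proj_linear].
- split; first by split=> //=; apply: (sub_of_projK D); rewrite linear0.
  move=> k x y [ax xE] [ay yE]; split=> /=; last by rewrite xE yE.
  exact: (sub_lin D).
- apply/seteqP; split=> [[X Y] [/= gX aY]|_ [x [y [/mtildeP[gx xE] [ay yE] ->]]]].
    have [e1 e2] := opIB_decomposition D X aY; do 2 eexists; split; last exact: e2.
    + apply/mtildeP; split=> /=; last by rewrite e1.
      apply: (amb_add D); last by apply: ag; exact: aZ.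
      by apply: gB => //; apply: ag; apply: aD => //; exact: aZ.
    + by split=> //=; apply: aD => //; apply: aD => //; exact: aZ.
  split=> /=; first by apply: (amb_add D) => //; exact: ag.
  by rewrite xE yE; apply: aD => //; exact: (sub_hatB D).
- apply/seteqP; split=> [z [/mtildeP[gz zE] [az z2]]|_ ->]; last first.
    split; first by apply/mtildeP; split=> //=; rewrite linear0 hatB0.
    by split=> //=; apply: (sub_of_projK D); rewrite linear0.
  have z0 : z.1 = 0 by apply: (hatB_fixed_eq0 D); rewrite -zE.
  by move: z z0 z2 {gz zE az} => [z1 z2] /= -> ->.
Qed.

Lemma decomposition_mh X Y : g X -> a Y ->
  let C := IB t B0 in let P0 := proj_a A form in
  let z := (X - C (P0 X) + t^-1 *: B0 Y, - C (P0 (X - Y))) in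
  let w := (Y + C (P0 (X - Y)), Y + C (P0 (X - Y))) in
  [/\ mtilde A form t B0 g z, a w.1 /\ w.2 = w.1 & (X, Y) = z + w].
Proof.
move=> gX aY C P0 z w; have gY := ag aY.
have [e1 e2] := opIB_decomposition D X aY.
rewrite /z /w /C /P0 !projE//; last exact: gB.
rewrite !IBE// B0E//; split=> //.
- apply/mtildeP; split=> /=; last by rewrite e1.
  apply: (amb_add D); last by apply: ag; exact: aZ.
  by apply: gB => //; apply: ag; apply: aD => //; exact: aZ.
- by split=> //=; apply: aD => //; apply: aD => //; exact: aZ.
Qed.

(** The projection is characterised by the decomposition, the complement being
    direct. *)
Lemma proj_along_mh X Y : g X -> a Y ->
  (proj_along (mtilde A form t B0 g) [set z | a z.1 /\ z.2 = z.1] (X, Y)).1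
  = X - opIB B t (P X) + t^-1 *: B Y.
Proof.
move=> gX aY; have [mz hw e2] := decomposition_mh gX aY.
have gY := ag aY.
move: mz hw e2; rewrite !projE//; last exact: gB.
rewrite !IBE// B0E//; set z := (_, _) => mz hw e2.
suff -> : proj_along (mtilde A form t B0 g) [set z | a z.1 /\ z.2 = z.1] (X, Y) = z.
  by [].
apply: xget_unique; first by split=> //; rewrite e2 addrC addKr.
move=> y [my [ay yE]]; have [_ _ _ mh0] := complementary_mh.
have sub1 u v : mtilde A form t B0 g u -> mtilde A form t B0 g v ->
    mtilde A form t B0 g (u - v).
  move=> mu mv; have [[_ mP] _ _ _] := complementary_mh.
  by rewrite -scaleN1r addrC; exact: mP.
have : (mtilde A form t B0 g `&` [set z | a z.1 /\ z.2 = z.1]) (y - z).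
  split; first exact: sub1.
  have zw : (X, Y) - z = (Y + opIB B t (P (X - Y)), Y + opIB B t (P (X - Y))).
    by rewrite e2 addrC addKr.
  have -> : y - z = ((X, Y) - z) - ((X, Y) - y).
    by rewrite opprB [RHS]addrC addrA subrK.
  rewrite zw; case: hw => aw _; split=> /=; last by move: yE => /= ->.
  by apply: aD => //; exact: (sub_opp D).
by rewrite mh0 => /eqP; rewrite subr_eq0 => /eqP.
Qed.

Lemma m_form_invariant : invariant_form ot Ht (mtilde A form t B0 g)
  (form_m A form t B0).
Proof.
split.
- split=> [x y /mtildeP[gx _] /mtildeP[gy _]|k x y z /mtildeP[gx _] /mtildeP[gy _] /mtildeP[gz _]].
    by rewrite !form_mE// !(m_formE D) (beta_formC D).
  rewrite !form_mE//; last exact: (md_gP D).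
  rewrite !(m_formE D) -(beta_formP D); congr beta_form.
  by rewrite hatB_proj_linear scalerBr opprD addrACA.
- move=> x mx x0; have /mtildeP[gx xE] := mx.
  have x1 : x.1 = 0.
    apply: (hatB_fixed_eq0 D); apply/eqP; rewrite -subr_eq0; apply/eqP.
    apply: (beta_form_nd D) => [|Y gY].
      by apply: gB => //; apply: ag; exact: (sub_hatB D).
    have [X gX ->] := sub_hatB_surj D gY.
    have := x0 (X, hatB S t (P X)); rewrite form_mE//= (m_formE D); apply.
    exact/mtildeP.
  by move: x1 xE; case: x {mx x0 gx} => x1 x2 /= -> ->; rewrite linear0 hatB0.
- move=> [k _] x y [/= Ak ->] /mtildeP[gx _] /mtildeP[gy _].
  have DT := Ad_metric_auto Ak.
  rewrite !form_mE//=; [|exact: (ma_Tg DT)..].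
  rewrite -!AdLE !(m_formE D) !(auto_proj D DT)// !(auto_hatB D DT)// -!linearB.
  by rewrite (beta_form_inv D DT)//; apply: gB => //; apply: ag; exact: (sub_hatB D).
Qed.

Lemma mtilde_Ad_invariant : Ad_invariant ot Ht (mtilde A form t B0 g).
Proof.
move=> [k _] x [/= Ak ->] /mtildeP[gx xE]; have DT := Ad_metric_auto Ak.
apply/mtildeP; split=> /=; first exact: (ma_Tg DT).
by rewrite xE -!AdLE !(auto_proj D DT)// !(auto_hatB D DT).
Qed.

(** Bi-invariance of the form and of its twist by B gives the bracket identities
    which [nr_cyclic] needs. *)
Lemma natural_reductivity : nr_condition ot Ht (mtilde A form t B0 g)
  (form_m A form t B0).
Proof.
have htE := diag_lie_algebra sA.
move=> x y z /mtildeP[gx xE] /mtildeP[gy yE] /mtildeP[gz zE].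
rewrite htE.
have gbr u v : g u -> g v -> g (u *m v - v *m u) by exact: (bracket_closed mG).
have abr u v : a u -> a v -> a (u *m v - v *m u) by exact: (bracket_closed mA).
have fbr u v w : g u -> g v -> g w ->
    f (u *m v - v *m u) w = f (w *m u - u *m w) v.
  move=> gu gv gw; rewrite -!formE//; [|exact: gbr..].
  exact: (bracket_invariant mG).
have [B0a B0l B0s Bbi] := hB.
have symB : sym_form a (fun x y => form x (B0 y)).
  split=> [u v au av|k u v w au av aw].
    have [Bu Bv] := (B0a _ au, B0a _ av).
    by rewrite -B0s// (proj1 hform)//; exact: ag.
  by rewrite (proj2 hform)//; [exact: ag|exact: ag|exact/ag/B0a].
have Bbr u v w : a u -> a v -> a w ->
    f (u *m v - v *m u) (B w) = f (w *m u - u *m w) (B v).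
  move=> au av aw; rewrite -!B0E// -!formE;
    try (by apply: ag; first [exact: abr | exact: B0a]).
  exact: (bracket_invariant mA symB Bbi).
have key u v w : mtilde A form t B0 g w -> g u.1 -> g v.1 ->
    u.2 = hatB S t (P u.1) -> v.2 = hatB S t (P v.1) ->
  form_m A form t B0 w (proj_along (mtilde A form t B0 g)
     [set z | a z.1 /\ z.2 = z.1] (brk ot u v)) =
  m_form f P S t w.1 (m_proj1 P B S t u.1 v.1).
  move=> /mtildeP[gw _] gu gv uE vE.
  have gb := gbr _ _ gu gv.
  have ab : a (u.2 *m v.2 - v.2 *m u.2).
    by rewrite uE vE; apply: abr; exact: (sub_hatB D).
  have bE : brk ot u v = (u.1 *m v.1 - v.1 *m u.1, u.2 *m v.2 - v.2 *m u.2) by [].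
  rewrite bE form_mE//.
    by rewrite (proj_along_mh gb ab) /m_proj1 uE vE.
  rewrite (proj_along_mh gb ab).
  apply: (amb_add D); last by apply: ag; exact: aZ.
  by apply: gB => //; apply: ag; apply: aD => //; exact: aZ.
rewrite !key//; try exact/mtildeP.
exact: (nr_cyclic D gbr abr fbr Bbr).
Qed.

(** The left translate of the differential of the orbit map is Ad_{p2} (X - Y), and
    Ad_{p2} is an isometry of the form on [g]. *)
Lemma met_dorb p x y : pts Gt p -> (g `*` a) x -> (g `*` a) y ->
  left_metric o (form_beta A form t B0) (two_sided p 1%:M) (dorb p x) (dorb p y) =
  beta_form f P B t (x.1 - x.2) (y.1 - y.2).
Proof.
move=> [Gp Ap] [gx ax] [gy ay]; have DT := Ad_metric_auto Ap.
have u1 := mlg_unit mG Gp; have u2 := mlg_unit mA Ap.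
have gd z w : g z -> a w -> g (z - w) by move=> gz aw; apply: gB => //; exact: ag.
rewrite -(beta_form_inv D DT); [|exact: gd..].
rewrite -form_betaE; [|exact/(ma_Tg DT)/gd..].
(* At the point q = p1 p2^-1, the vector p1 v p2^-1 is q (p2 v p2^-1). *)
have uT : two_sided p 1%:M \in unitmx.
  by rewrite /two_sided mulmx1 unitmx_mul u1 unitmx_inv.
rewrite /left_metric /=.
have e v : dorb p v = two_sided p 1%:M *m (p.2 *m (v.1 - v.2) *m invmx p.2).
  by rewrite /dorb /two_sided mulmx1 !mulmxA mulmxKV.
by rewrite !e !mulKmx.
Qed.

Lemma diff_orb p v : pts Gt p ->
  'd (fun q => two_sided q 1%:M) p (gmul ot p v) = dorb p v.
Proof.
move=> [Gp Ap]; have [d Dd dE] := is_diff_orb (mlg_unit mA Ap).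
by rewrite (is_diffE _ Dd) dE.
Qed.

Lemma differentiable_orb p : pts Gt p ->
  differentiable (fun q : E * E => two_sided q 1%:M) p.
Proof.
move=> [Gp Ap]; have [d Dd dE] := is_diff_orb (mlg_unit mA Ap).
exact: (@ex_diff _ _ _ _ _ _ _ Dd).
Qed.

Lemma mtilde_sub z : mtilde A form t B0 g z -> (g `*` a) z.
Proof. by move=> /mtildeP[gz zE]; split=> //=; rewrite zE; exact: (sub_hatB D). Qed.

(** [m_formE] is exactly the compatibility required by [met_dorb]. *)
Lemma m_form_induces : induces ot Gt G (@two_sided R N) 1%:M
  (mtilde A form t B0 g) (form_m A form t B0) (left_metric o (form_beta A form t B0)).
Proof.
move=> p Gp; split; first exact: differentiable_orb.
- apply/seteqP; split=> [_ [x mx <-]|v].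
    by rewrite diff_orb//; apply: (dorb_closed mG sA) => //; exact: mtilde_sub.
  move=> /(dorb_surj mG sA Gp)[Y gY ->]; have [X gX ->] := sub_hatB_surj D gY.
  exists (X, hatB S t (P X)); first exact/mtildeP.
  by rewrite diff_orb.
- move=> x y mx my; rewrite !diff_orb// met_dorb//; [|exact: mtilde_sub..].
  have [[gx xE] [gy yE]] := ((mtildeP x).1 mx, (mtildeP y).1 my).
  by rewrite form_mE// (m_formE D) xE yE.
Qed.

(** Left translations disappear in a left-invariant metric; what remains of the
    right translation by p2^-1 is Ad_{p2}. *)
Lemma two_sided_isometric p : pts Gt p ->
  isometric G (left_metric o (form_beta A form t B0)) (two_sided p).
Proof.
move=> [Gp Ap] x Gx; have DT := Ad_metric_auto Ap.
have u1 := mlg_unit mG Gp; have u2 := mlg_unit mA Ap; have ux := mlg_unit mG Gx.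
have cT : continuous (mulmxr (invmx p.2) \o mulmx p.1 : {linear E -> E}).
  exact: linear_mx_continuous.
have DT' := is_diff_linear x cT.
split; first exact: (@ex_diff _ _ _ _ _ _ _ DT').
move=> xi eta /(tangentE mG _ Gx) gxi /(tangentE mG _ Gx) geta.
rewrite /left_metric /= !(is_diffE _ DT') /=.
have uT : two_sided p x \in unitmx.
  by rewrite /two_sided !unitmx_mul u1 ux unitmx_inv.
have e v : p.1 *m v *m invmx p.2 = two_sided p x *m AdL p.2 (invmx x *m v).
  by rewrite /two_sided AdLE !mulmxA mulmxKV// mulmxK.
rewrite !e !mulKmx// !form_betaE//; [|exact: (ma_Tg DT)..].
exact: (beta_form_inv D DT).
Qed.

Lemma beta_form_metric : sym_form g (form_beta A form t B0) /\
  nondegenerate_on g (form_beta A form t B0).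
Proof.
split; first split=> [x y gx gy|k x y z gx gy gz].
- by rewrite !form_betaE// (beta_formC D).
- by rewrite !form_betaE// ?(beta_formP D)//; exact: (md_gP D).
- move=> x gx x0; apply: (beta_form_nd D) => // y gy.
  by rewrite -form_betaE// x0.
Qed.

Lemma metric_naturally_reductive : naturally_reductive ot Gt Ht G
  (@two_sided R N) 1%:M (left_metric o (form_beta A form t B0)).
Proof.
split; first exact: (two_sided_homogeneous mG sA).
  by move=> p; exact: two_sided_isometric.
exists (mtilde A form t B0 g), (form_m A form t B0); split.
- rewrite (prod_lie_algebra mG sA) (diag_lie_algebra sA).
  exact: complementary_mh.
- exact: mtilde_Ad_invariant.
- exact: m_form_invariant.
- exact: natural_reductivity.
- exact: m_form_induces.
Qed.

Section submersion.
Hypothesis hC : set_bij a a (IB t B0).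

(** B + beta0 is a nonzero multiple of I + beta0^-1 B. *)
Lemma Bplus_bij : set_bij a a (Bplus t B0).
Proof.
have BpE x : Bplus t B0 x = t *: IB t B0 x.
  by rewrite /Bplus /IB scalerDr scalerA mulfV// scale1r addrC.
have [Cf Ci Cs] := hC; split.
- by move=> x ax; rewrite BpE; apply: aZ; exact: Cf.
- by move=> x y ax ay; rewrite !BpE => /(scalerI t0); exact: Ci.
- move=> y ay; have [x ax xE] := Cs _ (aZ t^-1 ay).
  by exists x => //; rewrite BpE xE scalerA mulfV// scale1r.
Qed.

Lemma Bplus_inverse : exists Q : {linear E -> E},
  [/\ forall x, a (Q x), forall x, a x -> B (Q x) + t *: Q x = x,
      forall x, a x -> Q (B x + t *: x) = x &
      forall x, a x -> inv_on a (Bplus t B0) x = Q x].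
Proof.
have sa : is_subspace a by move=> k x y; exact: (sub_lin D).
have lBp : linear_on a (Bplus t B0).
  by move=> k x y ax ay; rewrite !BplusE//; [rewrite linearP; mxfield|exact: sa].
have [iV hi ih] := inv_on_spec Bplus_bij.
have [Q [QE QE']] := linear_on_extend Pa (md_Pid D) (inv_on_linear sa Bplus_bij lBp).
have [Bpa _ _] := Bplus_bij.
exists Q; split=> //.
- by move=> x; rewrite QE; exact: iV.
- by move=> x ax; rewrite -BplusE -QE'//; [exact: hi|exact: iV].
- by move=> x ax; rewrite -BplusE// -QE' ?ih//; exact: Bpa.
Qed.

Section with_inverse.
Variable Q : {linear E -> E}.
Hypothesis Qa : forall x, a (Q x).
Hypothesis BQ : forall x, a x -> B (Q x) + t *: Q x = x.
Hypothesis QB : forall x, a x -> Q (B x + t *: x) = x.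
Hypothesis QE : forall x, a x -> inv_on a (Bplus t B0) x = Q x.

Lemma form_GtE z w : (g `*` a) z -> (g `*` a) w -> form_Gt A form t B0 z w =
  t * f z.1 w.1 - f (t *: B (Q z.2)) w.2.
Proof.
move=> [gz az] [gw aw]; rewrite /form_Gt formE// QE// B0E//.
by rewrite formE//; apply: ag => //; exact: aZ.
Qed.

Lemma form_Gt_m z w : mtilde A form t B0 g z -> mtilde A form t B0 g w ->
  form_Gt A form t B0 z w = form_m A form t B0 z w.
Proof.
move=> mz mw; rewrite form_GtE; [|exact: mtilde_sub..].
have [[gz zE] [gw wE]] := ((mtildeP z).1 mz, (mtildeP w).1 mw).
by rewrite form_mE// zE wE (product_form_on_m D QB).
Qed.

Lemma form_Gt_metric : sym_form (g `*` a) (form_Gt A form t B0) /\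
  nondegenerate_on (g `*` a) (form_Gt A form t B0).
Proof.
have fPl := md_fP D; split; first split.
- move=> x y gx gy; have [[gx1 ax2] [gy1 ay2]] := (gx, gy).
  rewrite !form_GtE// fC !(form_scalel D).
  by rewrite (BQ_sym D Qa BQ QB)// [f x.2 _]fC.
- move=> k x y z gx gy gz; have [[gx1 ax2] [gy1 ay2]] := (gx, gy).
  rewrite !form_GtE//; last first.
    by split; [exact: (md_gP D)|exact: (sub_lin D)].
  have -> : (k *: x + y).1 = k *: x.1 + y.1 by [].
  have -> : (k *: x + y).2 = k *: x.2 + y.2 by [].
  by rewrite !(form_scalel D) !(linop_add, linop_scale) !fPl; ring.
- move=> x gx x0; have [gx1 ax2] := gx.
  have a0 : a 0 by apply: (sub_of_projK D); rewrite linear0.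
  have x1 : x.1 = 0.
    apply: (md_fndg D) => // y gy; have := x0 (y, 0) (conj gy a0).
    rewrite form_GtE// /= [f _ 0]fC (form_0l D) subr0 => /eqP.
    by rewrite mulf_eq0 (negbTE t0) => /eqP.
  have x2 : x.2 = 0.
    apply: (BQ_eq0 D Qa BQ) => //; apply: (md_fnda D) => // y ay.
    have := x0 (0, y) (conj (ag a0) ay).
    rewrite form_GtE//=; last by split => //; exact: (ag a0).
    rewrite [f _ 0]fC (form_0l D) mulr0 sub0r (form_scalel D) => /eqP.
    by rewrite oppr_eq0 mulf_eq0 (negbTE t0) => /eqP.
  by move: x1 x2; case: x {gx x0 gx1 ax2} => x1 x2 /= -> ->.
Qed.

(** The inverse of B + beta0 commutes with Ad_A because B does. *)
Lemma form_Gt_bi_invariant : bi_invariant ot Gt (form_Gt A form t B0).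
Proof.
move=> p y z [Gp Ap]; rewrite (prod_lie_algebra mG sA) => gy gz.
have [[gy1 ay2] [gz1 az2]] := (gy, gz).
have DT := Ad_metric_auto Ap.
have Adg x : (g `*` a) x -> (g `*` a) (Ad ot p x).
  by move=> [gx ax]; split; [exact: (Ad_closed mG)|exact: (Ad_closed mA)].
have [gAy gAz] := (Adg _ gy, Adg _ gz).
rewrite !form_GtE//; congr (_ * _ - _).
  have [[gAy1 _] [gAz1 _]] := (gAy, gAz).
  by rewrite -!formE//; exact: hbi.
rewrite !(form_scalel D); congr (_ * _); rewrite /Ad /= -!AdLE.
rewrite (auto_Q Qa BQ QB (ma_Ta DT) (auto_B D DT))// (auto_B D DT)// (ma_Tf DT)//; exact: ag.
Qed.

(** Vertical vectors at p are translates of diagonal ones, so horizontal vectors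
    are translates of elements of m, where the form on g x a is the form on m. *)
Lemma qmap_pr_submersion : pr_submersion Gt (left_metric ot (form_Gt A form t B0))
  G (left_metric o (form_beta A form t B0)) (@qmap R N).
Proof.
have A1 := mlg1 mA.
split; first exact: (smooth_qmap mG sA).
  move=> y Gy; exists (y, 1%:M); first by split.
  by rewrite /qmap /= invmx1 mulmx1.
move=> p Gp vert horiz; rewrite qmapE in vert horiz *.
have tP := prod_tangentP mG sA _ Gp.
have u1 : p.1 \in unitmx by case: Gp => /= Gp _; exact: (mlg_unit mG Gp).
have u2 : p.2 \in unitmx by case: Gp => /= _ Ap; exact: (mlg_unit mA Ap).
have dorb0 x : dorb p x = 0 <-> x.2 = x.1.
  rewrite /dorb; split=> [e|->]; last by rewrite subrr mulmx0 mul0mx.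
  have := congr1 (fun M => invmx p.1 *m (M *m p.2)) e.
  rewrite mulmxKV// mulKmx// mul0mx mulmx0 => /eqP.
  by rewrite subr_eq0 => /eqP.
have metE x y : left_metric ot (form_Gt A form t B0) p (gmul ot p x) (gmul ot p y)
    = form_Gt A form t B0 x y.
  by rewrite /left_metric !(gmulK mG sA).
have vertP y : a y -> vert (gmul ot p (y, y)).
  move=> ay; split; first by apply/tP; exists (y, y) => //; split=> //; exact: ag.
  by rewrite diff_orb//; exact/dorb0.
split.
- exact: differentiable_orb.
- move=> v /(dorb_surj mG sA Gp)[Y gY ->].
  have a0 : a 0 by apply: (sub_of_projK D); rewrite linear0.
  exists (gmul ot p (Y, 0)); first by apply/tP; exists (Y, 0).
  by rewrite diff_orb// /dorb subr0.
- move=> _ [/tP[x gx ->] + x0]; rewrite diff_orb// => /dorb0 x21.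
  have [gx1 ax2] := gx.
  have x2 : x.2 = 0.
    apply: (vertical_nondegenerate D Qa BQ) => // y ay.
    have := x0 _ (vertP y ay); rewrite metE form_GtE//=.
      by rewrite -x21.
    by split=> //; exact: ag.
  have -> : x = 0.
    by move: x21 x2; case: x {gx x0 gx1 ax2} => x1 x2 /= -> ->.
  by rewrite /= !mulmx0.
- move=> _ _ [/tP[x gx ->] hx] [/tP[y gy ->] hy].
  have horizP z : (g `*` a) z -> (forall nu, vert nu ->
      left_metric ot (form_Gt A form t B0) p (gmul ot p z) nu = 0) ->
      mtilde A form t B0 g z.
    move=> gz hz; have [gz1 az2] := gz; apply/mtildeP; split=> //.
    apply: (horizontal_in_m D Qa BQ) => // H aH.
    have := hz _ (vertP H aH); rewrite metE form_GtE//.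
    by split=> //; exact: ag.
  have [mx my] := (horizP _ gx hx, horizP _ gy hy).
  rewrite metE form_Gt_m//.
  have [_ _ -> //] := m_form_induces Gp.
Qed.

End with_inverse.
End submersion.

End naturally_reductive_metric.

(** * The theorem *)

Unset Implicit Arguments.

Theorem theorem1 (R : realType) (N : nat) (G A : submfd 'M[R]_N)
    (form : 'M[R]_N -> 'M[R]_N -> R) (B : 'M[R]_N -> 'M[R]_N) (beta0 : R)
    (g := lie_algebra (GL_ops R N) G) (a := lie_algebra (GL_ops R N) A)
    (hG : matrix_lie_group G) (hGc : mfd_connected G)
    (hform : sym_form g form) (hnd : nondegenerate_on g form)
    (hbi : bi_invariant (GL_ops R N) G form)
    (hA : lie_subgroup (GL_ops R N) A G) (hAc : mfd_connected A)
    (hnda : nondegenerate_on a form)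
    (hB : intertwining (GL_ops R N) A form B) (hBinv : set_bij a a B)
    (hbeta0 : beta0 != 0) :
  let P := proj_a A form in
  let C := IB beta0 B in
  let ot := prod_ops (GL_ops R N) (GL_ops R N) in
  let Gt := prod_submfd G A in
  let Ht := diag_submfd A in
  let gt := lie_algebra ot Gt in
  let ht := lie_algebra ot Ht in
  let mt := mtilde A form beta0 B g in
  let met := left_metric (GL_ops R N) (form_beta A form beta0 B) in
  let bm := form_m A form beta0 B in
  let bG := form_Gt A form beta0 B in
  [/\ sym_form g (form_beta A form beta0 B) /\
      nondegenerate_on g (form_beta A form beta0 B),
      naturally_reductive ot Gt Ht G (@two_sided R N) 1%:M met,
      (gt = g `*` a /\ ht = [set z | a z.1 /\ z.2 = z.1]) /\
      (complementary gt mt ht /\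
       forall X Y, g X -> a Y ->
         let z := (X - C (P X) + beta0^-1 *: B Y, - C (P (X - Y))) in
         let w := (Y + C (P (X - Y)), Y + C (P (X - Y))) in
         [/\ mt z, ht w & (X, Y) = z + w]),
      [/\ Ad_invariant ot Ht mt,
          invariant_form ot Ht mt bm,
          nr_condition ot Ht mt bm &
          induces ot Gt G (@two_sided R N) 1%:M mt bm met] &
      set_bij a a C ->
      [/\ sym_form gt bG /\ nondegenerate_on gt bG,
          bi_invariant ot Gt bG,
          (forall z w, mt z -> mt w -> bG z w = bm z w) &
          pr_submersion Gt (left_metric ot bG) G met (@qmap R N)]].
Proof.
move=> P C ot Gt Ht gt ht mt met bm bG.
have mA := subgroup_mlg hG hA; have ag := subgroup_lie_algebra hG hA.
have [d [L [_ gE]]] := tangent_param_mlg hG (mlg1 hG).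
have [e [M [iM aE]]] := tangent_param_mlg mA (mlg1 mA).
have [_ lB sB _] := hB.
have [f [P' [B' [S' [D [formE projE B0E B0VE]]]]]] :
    exists f (P' B' S' : {linear 'M[R]_N -> 'M[R]_N}),
    metric_data g a f P' B' S' beta0 /\
    [/\ forall x y, g x -> g y -> form x y = f x y,
        forall x, g x -> proj_a A form x = P' x,
        forall x, a x -> B x = B' x &
        forall x, a x -> Binv A B x = S' x].
  rewrite /g /a /proj_a /Binv /lie_algebra gE aE.
  apply: metric_data_exists => //; rewrite -?gE -?aE //.
have hgt : gt = g `*` a := prod_lie_algebra hG hA.
have hht : ht = [set z | a z.1 /\ z.2 = z.1] := diag_lie_algebra hA.
have nr := metric_naturally_reductive hG hA hform hbi hB D formE projE B0E B0VE.
split.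
- exact: (beta_form_metric hG hA D formE projE B0E).
- exact: nr.
- split=> //; split; first rewrite hgt hht.
    exact: (complementary_mh hG hA D projE B0E B0VE).
  move=> X Y gX aY; rewrite hht.
  exact: (decomposition_mh hG hA D projE B0E B0VE gX aY).
- split.
  + exact: (mtilde_Ad_invariant hG hA hbi hB D formE projE B0E B0VE).
  + exact: (m_form_invariant hG hA hbi hB D formE projE B0E B0VE).
  + exact: (natural_reductivity hG hA hform hbi hB D formE projE B0E B0VE).
  + exact: (m_form_induces hG hA hbi hB D formE projE B0E B0VE).
- move=> hC.
  have [Q [Qa BQ QB QE]] := Bplus_inverse D B0E hC.
  split.
  + rewrite hgt; exact: (form_Gt_metric hG hA D formE B0E Qa BQ QB QE).
  + exact: (form_Gt_bi_invariant hG hA hbi hB D formE B0E Qa BQ QB QE).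
  + exact: (form_Gt_m hG hA D formE projE B0E B0VE Qa QB QE).
  + exact: (qmap_pr_submersion hG hA hbi hB D formE projE B0E B0VE Qa BQ QB QE).
Qed.
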